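(* Let $\mathcal{O}$ be a polynomial ring over a field $k$ of characteristic $0$. Let $\mathfrak{h}\subset\mathfrak{g}$ be unmixed ideals of $\mathcal{O}$ with $\mathfrak{g}$ radical, such that the Jacobian ideal $\mathcal{J}(\mathfrak{h})$ of $\mathfrak{h}$ is not contained in any minimal prime of $\mathcal{O}/\mathfrak{g}$. Let $\bar{\mathfrak{g}}:=\mathfrak{g}/\mathfrak{h}\subset\mathcal{O}/\mathfrak{h}$ and $M:=\bar{\mathfrak{g}}/\bar{\mathfrak{g}}^2\cong\mathfrak{g}/(\mathfrak{g}^2+\mathfrak{h})$. Then $$T(M)=\frac{\int_{\mathfrak{h}}\mathfrak{g}}{\mathfrak{g}^2+\mathfrak{h}}\simeq\frac{\bar{\mathfrak{g}}^{(2)}}{\bar{\mathfrak{g}}^2}.$$ Consequently, there is an exact sequence $$0\longrightarrow T(M)\longrightarrow M\longrightarrow N\longrightarrow 0,\qquad N:=\mathfrak{g}\Big/\int_{\mathfrak{h}}\mathfrak{g},$$ where the first map is the inclusion and the second is the canonical projection.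
   Context: Let $\operatorname{Der}(\mathcal{O})$ be the module of $k$-derivations of $\mathcal{O}$ and $\operatorname{Der}_{\mathfrak{h}}(\mathcal{O})=\{\xi\in\operatorname{Der}(\mathcal{O}) : \xi(\mathfrak{h})\subset\mathfrak{h}\}$. The primitive ideal of $\mathfrak{g}$ relative to $\mathfrak{h}$ is $\int_{\mathfrak{h}}\mathfrak{g}=\{f\in\mathfrak{g} : \xi(f)\in\mathfrak{g}\text{ for all }\xi\in\operatorname{Der}_{\mathfrak{h}}(\mathcal{O})\}$; it contains $\mathfrak{g}^2+\mathfrak{h}$. An ideal is unmixed if all its associated primes have the same height. The Jacobian ideal $\mathcal{J}(\mathfrak{h})$ is generated by $\mathfrak{h}$ and the $p\times p$ minors of the Jacobian matrix of a generating set of $\mathfrak{h}$, $p$ being the height (grade) of $\mathfrak{h}$. A ''minimal prime of $\mathcal{O}/\mathfrak{g}$'' means a prime of $\mathcal{O}$ minimal over $\mathfrak{g}$. $M$ is regarded as an $\mathcal{O}/\mathfrak{g}$-module, and $T(M)$ is its torsion part: the kernel of $M\to M\otimes Q$, where $Q$ is the total quotient ring of $\mathcal{O}/\mathfrak{g}$ (i.e. the elements killed by some non-zero divisor of $\mathcal{O}/\mathfrak{g}$). $\bar{\mathfrak{g}}^{(2)}$ is the second symbolic power of the radical ideal $\bar{\mathfrak{g}}$: the set of $x\in\mathcal{O}/\mathfrak{h}$ such that $sx\in\bar{\mathfrak{g}}^2$ for some $s$ lying in no minimal prime of $\bar{\mathfrak{g}}$. *)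

(* Defs.v *)
From HB Require Import structures.
From mathcomp Require Import all_boot all_algebra.
From mathcomp Require Import boolp.
From mathcomp Require Import mpoly.

Set Implicit Arguments.
Unset Strict Implicit.
Unset Printing Implicit Defensive.

Import GRing.Theory.
Local Open Scope ring_scope.
Local Open Scope quotient_scope.

(* The library ideals [idealr] and their quotient rings are proper and
   non-trivial by definition.  Here an ideal of A is a submodule of the regular
   module A^o (possibly all of A), predicates are made boolean with the
   classical [`[< _ >]], and rings may be trivial ([pzRing]). *)

Section Submodules.
Variables (A : pzRingType) (V : lmodType A).

Section OfProp.
Variables (S : V -> Prop).
Hypotheses (S0 : S 0) (Slin : forall a u v, S u -> S v -> S (a *: u + v)).

Lemma submod_of_prop_closed :
  GRing.subsemimod_closed ((fun x => `[< S x >]) : {pred V}).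
Proof.
apply: GRing.submod_closed_semi; split=> [|a u v].
  exact: (asboolT S0).
by move=> /asboolW Su /asboolW Sv; apply: (asboolT (Slin a Su Sv)).
Qed.

Definition submod_of_prop : submodClosed V :=
  HB.pack (fun x => `[< S x >])
    (GRing.isSubmodClosed.Build A V _ submod_of_prop_closed).

Lemma submod_of_propP x : reflect (S x) (x \in submod_of_prop).
Proof. exact: asboolP. Qed.
End OfProp.

Variable W : submodClosed V.

Record submod_of := SubmodOf {submod_val : V; submod_valP : submod_val \in W}.
HB.instance Definition _ := [isSub for submod_val].
HB.instance Definition _ := [Choice of submod_of by <:].
HB.instance Definition _ := [SubChoice_isSubLmodule of submod_of by <:].

Definition submod_zmod : {pred V} := fun x => x \in W.

Lemma submod_zmod_closed : zmod_closed submod_zmod.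
Proof. exact: (GRing.submod_closedB (GRing.submodClosedP W)). Qed.

HB.instance Definition _ :=
  GRing.isZmodClosed.Build V submod_zmod submod_zmod_closed.

Definition mquot : Type := {ideal_quot submod_zmod}.
HB.instance Definition _ := GRing.Zmodule.on mquot.
HB.instance Definition _ := EqQuotient.on mquot.

Lemma mquot_eqP (x y : V) :
  reflect (\pi_mquot x = \pi_mquot y) (x - y \in W).
Proof.
have -> : (x - y \in W) = Quotient.equiv submod_zmod x y by [].
by apply: (iffP idP) => [E|/eqmodP]; first exact/eqmodP.
Qed.

Definition mquot_scale (a : A) (x : mquot) : mquot := \pi_mquot (a *: repr x).

Lemma mquot_scale_pi a v : mquot_scale a (\pi_mquot v) = \pi_mquot (a *: v).
Proof.
apply/mquot_eqP; rewrite -scalerBr rpredZ //.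
by apply/mquot_eqP; rewrite reprK.
Qed.

Lemma mquot_piD (x y : V) : \pi_mquot (x + y) = \pi_mquot x + \pi_mquot y.
Proof. exact: (@Quotient.pi_add V submod_zmod x y). Qed.

Lemma mquot_piB (x y : V) : \pi_mquot (x - y) = \pi_mquot x - \pi_mquot y.
Proof.
by rewrite mquot_piD; congr (_ + _); exact: (@Quotient.pi_opp V submod_zmod y).
Qed.

Fact mquot_scalerA a b x :
  mquot_scale a (mquot_scale b x) = mquot_scale (a * b) x.
Proof.
elim/quotW: x => x.
by rewrite (mquot_scale_pi b) (mquot_scale_pi a) mquot_scale_pi scalerA.
Qed.
Fact mquot_scale1r : left_id 1 mquot_scale.
Proof. by elim/quotW=> x; rewrite mquot_scale_pi scale1r. Qed.
Fact mquot_scalerDr : right_distributive mquot_scale +%R.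
Proof.
move=> a; elim/quotW=> x; elim/quotW=> y.
by rewrite -mquot_piD !mquot_scale_pi scalerDr mquot_piD.
Qed.
Fact mquot_scalerDl x : {morph mquot_scale^~ x : a b / a + b}.
Proof.
by move=> a b; elim/quotW: x => x; rewrite !mquot_scale_pi scalerDl mquot_piD.
Qed.
HB.instance Definition _ := GRing.Zmodule_isLmodule.Build A mquot
  mquot_scalerA mquot_scale1r mquot_scalerDr mquot_scalerDl.

Definition mproj (x : V) : mquot := \pi_mquot x.

Fact mproj_is_linear : linear mproj.
Proof.
move=> a x y; rewrite /mproj mquot_piD; congr (_ + _).
exact/esym/mquot_scale_pi.
Qed.
HB.instance Definition _ := GRing.isLinear.Build A V mquot _ mproj
  mproj_is_linear.

Lemma mproj_eqP (x y : V) : reflect (mproj x = mproj y) (x - y \in W).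
Proof. exact: mquot_eqP. Qed.

End Submodules.

(* J / I for submodules I, J of V, meant for I contained in J (in general this
   is J / (I \cap J)). *)
Section Subquotient.
Variables (A : pzRingType) (V : lmodType A) (J I : submodClosed V).

Lemma submod_trace0 : val (0 : submod_of J) \in I.
Proof. exact: rpred0. Qed.

Lemma submod_trace_lin a (u v : submod_of J) :
  val u \in I -> val v \in I -> val (a *: u + v) \in I.
Proof. by move=> Iu Iv; rewrite linearP rpredD ?rpredZ. Qed.

Definition submod_trace : submodClosed (submod_of J) :=
  submod_of_prop submod_trace0 submod_trace_lin.

Definition subquo : lmodType A := mquot submod_trace.

Definition sqcls (x : V) (Jx : x \in J) : subquo :=
  mproj submod_trace (SubmodOf Jx).

Variable K : submodClosed V.

Lemma subquo_sub0 :
  exists x (Jx : x \in J), x \in K /\ (0 : subquo) = sqcls Jx.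
Proof.
exists 0, (rpred0 J); split; first exact: rpred0.
rewrite /sqcls (_ : SubmodOf _ = 0) ?raddf0 //.
exact: val_inj.
Qed.

Lemma subquo_sub_lin a (u v : subquo) :
  (exists x (Jx : x \in J), x \in K /\ u = sqcls Jx) ->
  (exists x (Jx : x \in J), x \in K /\ v = sqcls Jx) ->
  exists x (Jx : x \in J), x \in K /\ a *: u + v = sqcls Jx.
Proof.
move=> [x [Jx [Kx ->]]] [y [Jy [Ky ->]]].
have Jxy : a *: x + y \in J by rewrite rpredD ?rpredZ.
exists (a *: x + y), Jxy; split; first by rewrite rpredD ?rpredZ.
rewrite /sqcls -linearP; congr (mproj _ _).
by apply: val_inj; rewrite linearP.
Qed.

(* K / I as a submodule of J / I *)
Definition subquo_sub : submodClosed subquo :=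
  submod_of_prop subquo_sub0 subquo_sub_lin.

End Subquotient.

Notation ideal A := (submodClosed (A^o)).

Section QuotientRing.
Variables (A : comPzRingType) (I : ideal A).

Definition rquot : Type := mquot I.
HB.instance Definition _ := GRing.Zmodule.on rquot.

Definition rproj (x : A) : rquot := mproj I (x : A^o).
Definition rrepr (x : rquot) : A := repr (x : mquot I).

Lemma rreprK : cancel rrepr rproj. Proof. exact: reprK. Qed.

Lemma rproj_eqP (x y : A) : reflect (rproj x = rproj y) (x - y \in I).
Proof. exact: mproj_eqP. Qed.

Lemma rrepr_proj x : rrepr (rproj x) - x \in I.
Proof. by apply/rproj_eqP; rewrite rreprK. Qed.

Lemma idealMr a (x : A) : x \in I -> a * x \in I.
Proof. exact: (@rpredZ A A^o I). Qed.

Fact rproj_zmod_morphism : zmod_morphism rproj.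
Proof. exact: (raddfB (mproj I)). Qed.
HB.instance Definition _ :=
  GRing.isZmodMorphism.Build A rquot rproj rproj_zmod_morphism.

Definition rquot_mul (x y : rquot) : rquot := rproj (rrepr x * rrepr y).

Lemma rquot_mul_proj x y : rquot_mul (rproj x) (rproj y) = rproj (x * y).
Proof.
apply/rproj_eqP.
have -> : rrepr (rproj x) * rrepr (rproj y) - x * y =
  rrepr (rproj x) * (rrepr (rproj y) - y) + y * (rrepr (rproj x) - x).
  by rewrite !mulrBr addrA [y * rrepr _]mulrC addrNK [y * x]mulrC.
by rewrite (rpredD (S := I)) // idealMr // rrepr_proj.
Qed.

Fact rquot_mulA : associative rquot_mul.
Proof.
move=> x y z; rewrite -[x]rreprK -[y]rreprK -[z]rreprK.
by rewrite !rquot_mul_proj mulrA.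
Qed.
Fact rquot_mulC : commutative rquot_mul.
Proof. by move=> x y; rewrite /rquot_mul mulrC. Qed.
Fact rquot_mul1 : left_id (rproj 1) rquot_mul.
Proof. by move=> x; rewrite -[x]rreprK rquot_mul_proj mul1r. Qed.
Fact rquot_mulDl : left_distributive rquot_mul +%R.
Proof.
move=> x y z; rewrite -[x]rreprK -[y]rreprK -[z]rreprK.
by rewrite -raddfD !rquot_mul_proj mulrDl raddfD.
Qed.
HB.instance Definition _ := GRing.Zmodule_isComPzRing.Build rquot
  rquot_mulA rquot_mulC rquot_mul1 rquot_mulDl.

Fact rproj_monoid_morphism : monoid_morphism rproj.
Proof. by split=> // x y; rewrite -rquot_mul_proj. Qed.
HB.instance Definition _ :=
  GRing.isMonoidMorphism.Build A rquot rproj rproj_monoid_morphism.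

End QuotientRing.

Section Restriction.
Variables (A B : pzRingType) (f : {rmorphism A -> B}) (V : lmodType B).

Definition restr_type : Type := V.
HB.instance Definition _ := GRing.Zmodule.on restr_type.

Definition restr_scale (a : A) (v : restr_type) : restr_type := f a *: (v : V).

Fact restr_scalerA a b x :
  restr_scale a (restr_scale b x) = restr_scale (a * b) x.
Proof. by rewrite /restr_scale scalerA rmorphM. Qed.
Fact restr_scale1r : left_id 1 restr_scale.
Proof. by move=> x; rewrite /restr_scale rmorph1 scale1r. Qed.
Fact restr_scalerDr : right_distributive restr_scale +%R.
Proof. by move=> a x y; rewrite /restr_scale scalerDr. Qed.
Fact restr_scalerDl x : {morph restr_scale^~ x : a b / a + b}.
Proof. by move=> a b; rewrite /restr_scale rmorphD scalerDl. Qed.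
HB.instance Definition _ := GRing.Zmodule_isLmodule.Build A restr_type
  restr_scalerA restr_scale1r restr_scalerDr restr_scalerDl.

Definition restr : lmodType A := restr_type.
End Restriction.

(* An A-module annihilated by the ideal I, regarded as an A/I-module. *)
Section Descent.
Variables (A : comPzRingType) (I : ideal A) (V : lmodType A).
Hypothesis IV0 : forall a (v : V), a \in I -> a *: v = 0.

Definition descent_type of (forall a (v : V), a \in I -> a *: v = 0) : Type :=
  V.
Local Notation D := (descent_type IV0).
HB.instance Definition _ := GRing.Zmodule.on D.

Definition descent_scale (a : rquot I) (v : D) : D := rrepr a *: (v : V).

Lemma descent_scale_proj a (v : D) : descent_scale (rproj I a) v = a *: (v : V).
Proof.
by apply/eqP; rewrite -subr_eq0 -scalerBl IV0 // rrepr_proj.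
Qed.

Fact descent_scalerA a b x :
  descent_scale a (descent_scale b x) = descent_scale (a * b) x.
Proof.
by rewrite -[a]rreprK -[b]rreprK -rmorphM !descent_scale_proj scalerA.
Qed.
Fact descent_scale1r : left_id 1 descent_scale.
Proof. by move=> x; rewrite -(rmorph1 (rproj I)) descent_scale_proj scale1r. Qed.
Fact descent_scalerDr : right_distributive descent_scale +%R.
Proof. by move=> a x y; rewrite /descent_scale scalerDr. Qed.
Fact descent_scalerDl x : {morph descent_scale^~ x : a b / a + b}.
Proof.
move=> a b; rewrite -[a]rreprK -[b]rreprK -rmorphD !descent_scale_proj.
exact: scalerDl.
Qed.
HB.instance Definition _ := GRing.Zmodule_isLmodule.Build (rquot I) D
  descent_scalerA descent_scale1r descent_scalerDr descent_scalerDl.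

Definition descent : lmodType (rquot I) := D.
End Descent.

Section Torsion.
Variables (Q : comPzRingType) (V : lmodType Q).

Definition nonzerodiv (s : Q) := forall t, s * t = 0 -> t = 0.

Lemma torsion0 : exists s : Q, nonzerodiv s /\ s *: (0 : V) = 0.
Proof. by exists 1; split=> [t|]; rewrite ?mul1r ?scaler0. Qed.

Lemma torsion_lin a (u v : V) :
  (exists s, nonzerodiv s /\ s *: u = 0) ->
  (exists s, nonzerodiv s /\ s *: v = 0) ->
  exists s, nonzerodiv s /\ s *: (a *: u + v) = 0.
Proof.
move=> [s [s_nzd su]] [t [t_nzd tv]]; exists (s * t); split.
  by move=> w; rewrite -mulrA => /s_nzd/t_nzd.
rewrite scalerDr -[(s * t) *: v]scalerA tv scaler0 addr0 scalerA.
by rewrite mulrC [s * t]mulrC mulrA -scalerA su scaler0.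
Qed.

Definition torsion : submodClosed V := submod_of_prop torsion0 torsion_lin.
End Torsion.

Section Ideals.
Variable A : comPzRingType.
Implicit Types (I J P : ideal A) (S : A -> Prop).

Lemma ideal_gen0 S J : (forall x, S x -> x \in J) -> (0 : A^o) \in J.
Proof. by move=> _; exact: rpred0. Qed.

Lemma ideal_gen_lin S a (u v : A^o) :
  (forall J, (forall x, S x -> x \in J) -> u \in J) ->
  (forall J, (forall x, S x -> x \in J) -> v \in J) ->
  forall J, (forall x, S x -> x \in J) -> a *: u + v \in J.
Proof. by move=> Su Sv J SJ; rewrite rpredD ?rpredZ ?Su ?Sv. Qed.

Definition ideal_gen S : ideal A :=
  submod_of_prop (@ideal_gen0 S) (@ideal_gen_lin S).

Definition ideal_add I J : ideal A := ideal_gen (fun x => x \in I \/ x \in J).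

Definition ideal_mul I J : ideal A :=
  ideal_gen (fun z => exists x y, [/\ x \in I, y \in J & z = x * y]).

Definition prime_ideal P :=
  1 \notin P /\ forall x y : A, x * y \in P -> (x \in P) || (y \in P).

Definition minimal_prime I P :=
  [/\ prime_ideal P, {subset I <= P} &
      forall Q : ideal A, prime_ideal Q -> {subset I <= Q} ->
        {subset Q <= P} -> {subset P <= Q}].

Definition radical_ideal I := forall (x : A) m, x ^+ m \in I -> x \in I.

(* There is a chain of prime ideals c 0 < ... < c m = P. *)
Definition prime_height_ge P (m : nat) :=
  exists c : nat -> ideal A,
    [/\ forall i, (i <= m)%N -> prime_ideal (c i),
        forall i, (i < m)%N ->
          {subset c i <= c i.+1} /\ ~ {subset c i.+1 <= c i} &
        c m =i P].

Definition prime_height P (m : nat) :=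
  prime_height_ge P m /\ ~ prime_height_ge P m.+1.

(* The height of I is m, as the minimum of the heights of the primes containing
   I; the unit ideal has no (finite) height. *)
Definition ideal_height I (m : nat) :=
  (exists P, [/\ prime_ideal P, {subset I <= P} & prime_height P m]) /\
  (forall P, prime_ideal P -> {subset I <= P} -> prime_height_ge P m).

Definition associated_prime I P :=
  prime_ideal P /\ exists x : A, forall a : A, (a \in P) = (a * x \in I).

Definition unmixed I :=
  forall P Q, associated_prime I P -> associated_prime I Q ->
    forall m, prime_height P m <-> prime_height Q m.

Lemma symbolic_square0 I : exists s : A,
  (forall P, minimal_prime I P -> s \notin P) /\ s * 0 \in ideal_mul I I.
Proof.
exists 1; split=> [P [[]] //|].
by rewrite mulr0 (rpred0 (ideal_mul I I)).
Qed.

Lemma symbolic_square_lin I a (u v : A^o) :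
  (exists s : A, (forall P, minimal_prime I P -> s \notin P) /\
                 s * u \in ideal_mul I I) ->
  (exists s : A, (forall P, minimal_prime I P -> s \notin P) /\
                 s * v \in ideal_mul I I) ->
  exists s : A, (forall P, minimal_prime I P -> s \notin P) /\
                s * (a *: u + v) \in ideal_mul I I.
Proof.
move=> [s [sP su]] [t [tP tv]]; exists (s * t); split=> [P mP|].
  have [[_ Pp] _ _] := mP; apply/negP => /Pp.
  by rewrite (negPf (sP _ mP)) (negPf (tP _ mP)).
have -> : s * t * (a *: u + v) = (t * a) * (s * u) + s * (t * v) :> A.
  rewrite mulrDr [s * t]mulrC -!mulrA.
  by rewrite [s * (a * _)]mulrCA [t * (s * v)]mulrCA.
by apply: (rpredD (S := ideal_mul I I)); apply: idealMr.
Qed.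

(* The second symbolic power of I (for I radical). *)
Definition symbolic_square I : ideal A :=
  submod_of_prop (@symbolic_square0 I) (@symbolic_square_lin I).

Lemma image_ideal0 I J : exists x : A, x \in J /\ (0 : rquot I) = rproj I x.
Proof. by exists 0; rewrite raddf0; split=> //; exact: (rpred0 J). Qed.

Lemma image_ideal_lin I J (a : rquot I) (u v : (rquot I)^o) :
  (exists x : A, x \in J /\ u = rproj I x) ->
  (exists x : A, x \in J /\ v = rproj I x) ->
  exists x : A, x \in J /\ a *: u + v = rproj I x.
Proof.
move=> [x [Jx ->]] [y [Jy ->]]; exists (rrepr a * x + y); split.
  by apply: (rpredD (S := J)) => //; apply: idealMr.
by rewrite rmorphD rmorphM /= rreprK.
Qed.

Definition image_ideal I J : ideal (rquot I) :=
  submod_of_prop (@image_ideal0 I J) (@image_ideal_lin I J).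

Lemma mem_image_ideal I J (x : A) : x \in J ->
  rproj I x \in image_ideal I J.
Proof. by move=> Jx; apply: asboolT; exists x. Qed.

Lemma mem_ideal_gen S (x : A) : S x -> x \in ideal_gen S.
Proof. by move=> Sx; apply: asboolT => J; apply. Qed.

Lemma mem_ideal_mul I J (x y : A) :
  x \in I -> y \in J -> x * y \in ideal_mul I J.
Proof. by move=> Ix Jy; apply: mem_ideal_gen; exists x, y. Qed.

Lemma mem_ideal_addl I J (x : A) : x \in I -> x \in ideal_add I J.
Proof. by move=> Ix; apply: mem_ideal_gen; left. Qed.

End Ideals.

Section SubquotientIdeals.
Variable A : comPzRingType.

Lemma subquo_annihilated (K J I : ideal A) :
  (forall a x : A, a \in K -> x \in J -> a * x \in I) ->
  forall a (v : subquo J I), a \in K -> a *: v = 0.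
Proof.
move=> KJI a v Ka; rewrite -[v]reprK -(raddf0 (mproj _)).
have -> : \pi_(mquot (submod_trace J I)) (repr v) = mproj _ (repr v) by [].
rewrite -linearZ; apply/mproj_eqP; rewrite subr0.
apply: asboolT; rewrite linearZ; apply: KJI => //.
exact: submod_valP.
Qed.

End SubquotientIdeals.

Section Conormal.
Variables (A : comPzRingType) (h g : ideal A).

Definition gbar : ideal (rquot h) := image_ideal h g.

Lemma conormal_annihilated a
  (v : restr (rproj h) (subquo gbar (ideal_mul gbar gbar))) :
  a \in g -> a *: v = 0.
Proof.
move=> ga; have gbar_a := mem_image_ideal h ga.
by apply: (subquo_annihilated _ _ gbar_a) => x y; apply: mem_ideal_mul.
Qed.

(* gbar / gbar^2 as an A/g-module *)
Definition conormal : lmodType (rquot g) := descent conormal_annihilated.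

Definition conormal_cls (x : A) (gx : x \in g) : conormal :=
  sqcls (ideal_mul gbar gbar) (mem_image_ideal h gx).

Definition sq_add : ideal A := ideal_add (ideal_mul g g) h.

Lemma lift_conormal_annihilated a (v : subquo g sq_add) :
  a \in g -> a *: v = 0.
Proof.
apply: subquo_annihilated => x y gx gy.
by apply/mem_ideal_addl/mem_ideal_mul.
Qed.

(* g / (g^2 + h) as an A/g-module *)
Definition lift_conormal : lmodType (rquot g) :=
  descent lift_conormal_annihilated.

End Conormal.

Section Derivations.
Variables (k : fieldType) (A : comAlgType k).

Definition derivation (xi : {linear A -> A}) :=
  forall x y : A, xi (x * y) = x * xi y + xi x * y.

Definition log_derivation (h : ideal A) (xi : {linear A -> A}) :=
  derivation xi /\ forall x : A, x \in h -> xi x \in h.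

Variables h g : ideal A.

Lemma primitive_ideal0 : (0 : A^o) \in g /\
  forall xi : {linear A -> A}, log_derivation h xi -> xi 0 \in g.
Proof. by split=> [|xi _]; rewrite ?raddf0; exact: (rpred0 g). Qed.

Lemma primitive_ideal_lin (a : A) (u v : A^o) :
  (u \in g /\
    forall xi : {linear A -> A}, log_derivation h xi -> xi u \in g) ->
  (v \in g /\
    forall xi : {linear A -> A}, log_derivation h xi -> xi v \in g) ->
  a *: u + v \in g /\
    forall xi : {linear A -> A}, log_derivation h xi -> xi (a *: u + v) \in g.
Proof.
move=> [gu Du] [gv Dv]; split=> [|xi Dxi]; first by rewrite rpredD ?rpredZ.
have -> : xi (a *: u + v) = (a * xi u + xi a * u) + xi v.
  by rewrite -Dxi.1 -raddfD.
apply: (rpredD (S := g)); last exact: Dv.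
by apply: (rpredD (S := g)); apply: idealMr => //; apply: Du.
Qed.

Definition primitive_ideal : ideal A :=
  submod_of_prop primitive_ideal0 primitive_ideal_lin.

Lemma primitive_quotient_annihilated a (v : subquo g primitive_ideal) :
  a \in g -> a *: v = 0.
Proof.
apply: subquo_annihilated => x y gx gy; apply: asboolT; split.
  exact: idealMr.
move=> xi [D _]; rewrite D; apply: (rpredD (S := g)).
  by rewrite mulrC; apply: idealMr.
exact: idealMr.
Qed.

(* N = g / primitive_ideal as an A/g-module *)
Definition primitive_quotient : lmodType (rquot g) :=
  descent primitive_quotient_annihilated.

End Derivations.

(* The Jacobian ideal of h computed from the generators f.  The row and column
   selections s, t are arbitrary maps: a repeated index gives a zero minor, and
   the order of the indices only affects the sign. *)
Definition jacobian_ideal (k : fieldType) (n : nat) (h : ideal {mpoly k[n]})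
    (r : nat) (f : 'I_r -> {mpoly k[n]}) : ideal {mpoly k[n]} :=
  ideal_gen (fun x : {mpoly k[n]} => x \in h \/
    exists (p : nat) (s : 'I_p -> 'I_r) (t : 'I_p -> 'I_n),
      ideal_height h p /\
      x = \det (mxsub s t (\matrix_(i < r, j < n) mderiv j (f i)))).

Definition short_exact (A : pzRingType) (U V W : lmodType A)
    (i : {linear U -> V}) (p : {linear V -> W}) :=
  [/\ injective i, forall v, p v = 0 <-> exists u, i u = v &
      forall w, exists v, p v = w].

(* Main.v *)
Require Import Defs.
From HB Require Import structures.
From mathcomp Require Import all_boot all_algebra.
From mathcomp Require Import boolp.
From mathcomp Require Import ring.
From mathcomp Require Import mpoly.
Import GRing.Theory.
Local Open Scope ring_scope.

(* Let P be a minimal prime of g.  A nonvanishing p x p minor of the Jacobian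
   matrix gives F_1, ..., F_p in h and derivations E_l of O killing them.  In
   characteristic 0 a prime Q of O is cut out modulo Q^2 by the partial
   derivatives, so if Q does not contain the minor, any x in Q with all E_l x
   in Q lies in Q^2 + (F) locally at Q.  When Q is an associated prime of h
   inside P, an x in Q with E_l x outside Q would make the height of Q exceed p;
   hence Q = (F) locally at Q, by Nakayama.  Since h is unmixed, it follows that E_l
   preserves h locally at P, and some multiple s E_l with s outside P lies in
   Der_h(O).  For x in the primitive ideal this gives E_l x in P, that is,
   x in P^2 + h = g^2 + h locally at P.  So x is torsion modulo g^2 + h.
   Conversely, a derivation preserving h maps g^2 + h into g. *)

Set Implicit Arguments.
Unset Strict Implicit.
Unset Printing Implicit Defensive.

(** * Ideals *)

Section IdealTheory.
Variable A : comPzRingType.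
Implicit Types (I J K P Q : ideal A) (a b q s t u v w x y z : A)
  (S : A -> Prop).

Lemma ideal0 I : (0 : A) \in I.
Proof. exact: (rpred0 I). Qed.

Lemma idealD I x y : x \in I -> y \in I -> x + y \in I.
Proof. exact: (@rpredD _ I). Qed.

Lemma ideal_mulr I a x : x \in I -> a * x \in I.
Proof. exact: (@rpredZ A A^o I). Qed.

Lemma idealB I x y : x \in I -> y \in I -> x - y \in I.
Proof. by move=> Ix Iy; rewrite -mulN1r idealD 1?ideal_mulr. Qed.

Lemma ideal_mull I x y : x \in I -> x * y \in I.
Proof. by move=> Ix; rewrite mulrC ideal_mulr. Qed.

Lemma ideal_sum I (T : Type) (r : seq T) (p : pred T) (F : T -> A) :
  (forall i, p i -> F i \in I) -> \sum_(i <- r | p i) F i \in I.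
Proof. by move=> IF; apply: (big_ind (fun x : A => x \in I)) => //;
  [exact: ideal0|exact: idealD]. Qed.

(** Ideals as [Prop]-valued predicates: sets given by existential conditions, such as [loc], need
    not be packed as ideals to serve in inductions over generators. *)
Definition ideal_like S :=
  [/\ S 0, forall x y, S x -> S y -> S (x + y) & forall a x, S x -> S (a * x)].

Lemma ideal_likeP S : ideal_like S -> exists I : ideal A, forall x,
  x \in I <-> S x.
Proof.
move=> [S0 SD SM].
have Sl (a : A) (u v : A^o) : S u -> S v -> S (a *: u + v).
  by move=> Su Sv; apply: SD => //; apply: SM.
by exists (submod_of_prop S0 Sl) => x; split=> [/asboolW|Sx] //;
  exact: asboolT.
Qed.

Lemma mem_ideal_like I : ideal_like (fun x : A => x \in I).
Proof. by split=> [|x y|a x];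
  [exact: ideal0|exact: idealD|exact: ideal_mulr]. Qed.

Lemma ideal_gen_ind S S' : ideal_like S' -> (forall x, S x -> S' x) ->
  forall x, x \in ideal_gen S -> S' x.
Proof.
move=> /ideal_likeP[I IP] SS' x /asboolW/(_ I) xI.
by apply/IP/xI => y Sy; apply/IP/SS'.
Qed.

Lemma ideal_gen_sub S I : (forall x, S x -> x \in I) ->
  {subset ideal_gen S <= I}.
Proof. by move=> SI x; apply: (ideal_gen_ind (mem_ideal_like I)). Qed.

Lemma mem_ideal_addr I J x : x \in J -> x \in ideal_add I J.
Proof. by move=> Jx; apply: mem_ideal_gen; right. Qed.

Lemma ideal_add_sub I J K :
  {subset I <= K} -> {subset J <= K} -> {subset ideal_add I J <= K}.
Proof. by move=> IK JK; apply: ideal_gen_sub => x [/IK|/JK]. Qed.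

Lemma ideal_mul_sub I J K :
  (forall x y, x \in I -> y \in J -> x * y \in K) ->
  {subset ideal_mul I J <= K}.
Proof. by move=> IJK; apply: ideal_gen_sub => _ [x [y [Ix Jy ->]]];
  apply: IJK. Qed.

Lemma prime_mulN P x y :
  prime_ideal P -> x \notin P -> y \notin P -> x * y \notin P.
Proof. by move=> [_ Pp] xP yP; apply/negP => /Pp/orP[]; apply/negP. Qed.

Lemma prime_cancel P x y :
  prime_ideal P -> x \notin P -> x * y \in P -> y \in P.
Proof. by move=> [_ Pp] /negPf xP /Pp; rewrite xP. Qed.

Lemma prime_expN P x m : prime_ideal P -> x \notin P -> x ^+ m \notin P.
Proof.
move=> Pp xP; elim: m => [|m IHm]; first by rewrite expr0; case: Pp.
by rewrite exprS prime_mulN.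
Qed.

Lemma idealBN P x y : x \notin P -> y \in P -> x - y \notin P.
Proof. by move=> + Py; apply: contra => /idealD/(_ Py); rewrite subrK. Qed.

(* The elements of A whose image in A_P lies in I A_P. *)
Definition loc P I x := exists2 s : A, s \notin P & s * x \in I.

Lemma mem_loc P I x : prime_ideal P -> x \in I -> loc P I x.
Proof. by move=> [P1 _] Ix; exists 1; rewrite ?mul1r. Qed.

Lemma loc_ideal_like P I : prime_ideal P -> ideal_like (loc P I).
Proof.
move=> Pp; split=> [|x y [s sP sx] [t tP ty]|a x [s sP sx]].
- exact/mem_loc/ideal0.
- exists (s * t); first exact: prime_mulN.
  have -> : s * t * (x + y) = t * (s * x) + s * (t * y) by ring.
  by rewrite idealD 1?ideal_mulr.
- by exists s; rewrite // mulrCA ideal_mulr.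
Qed.

Lemma loc_cancel P I s x : prime_ideal P -> s \notin P -> loc P I (s * x) ->
  loc P I x.
Proof.
by move=> Pp sP [t tP]; rewrite mulrA; exists (t * s); rewrite // prime_mulN.
Qed.

Lemma loc_sub P Q I J x : {subset Q <= P} -> {subset I <= J} ->
  loc P I x -> loc Q J x.
Proof.
move=> QP IJ [s sP /IJ sx]; exists s => //.
by apply: contra sP; apply: QP.
Qed.

Lemma loc_idem P I J x : prime_ideal P -> (forall y, y \in I -> loc P J y) ->
  loc P I x -> loc P J x.
Proof. by move=> Pp IJ [s sP /IJ]; apply: loc_cancel. Qed.

(** J is I + (y), described elementwise rather than by generators. *)
Lemma ideal_adjoin I y :
  exists J : ideal A, forall x, x \in J <-> exists a, x - a * y \in I.
Proof.
apply: ideal_likeP; split=> [|x z [a xa] [b zb]|a x [b xb]].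
- by exists 0; rewrite mul0r subr0 ideal0.
- exists (a + b);
    have -> : x + z - (a + b) * y = (x - a * y) + (z - b * y) by ring.
  exact: idealD.
- exists (a * b); have -> : a * x - a * b * y = a * (x - b * y) by ring.
  exact: ideal_mulr.
Qed.

Lemma ideal_colon I y :
  exists J : ideal A, forall x, x \in J <-> x * y \in I.
Proof.
apply: ideal_likeP; split=> [|x z Ix Iz|a x Ix].
- by rewrite mul0r ideal0.
- by rewrite mulrDl idealD.
- by rewrite -mulrA ideal_mulr.
Qed.

(** The maximal condition; maximality is expressed by inclusions, so that equality of ideals never
    has to be discussed. *)
Definition noetherian := forall F : ideal A -> Prop, (exists I, F I) ->
  exists2 I, F I & forall J, F J -> {subset I <= J} -> {subset J <= I}.

Definition nzd_mod I (s : A) := forall t, s * t \in I -> t \in I.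

(** * Primes, zero divisors and Nakayama's lemma in a Noetherian ring *)

Hypothesis noethA : noetherian.

(** An ideal maximal among those containing I and disjoint from a multiplicative set is prime. *)
Lemma exists_prime_disjoint I S :
  S 1 -> (forall x y, S x -> S y -> S (x * y)) ->
  (forall x, S x -> x \notin I) ->
  exists Q, [/\ prime_ideal Q, {subset I <= Q} & forall x, S x -> x \notin Q].
Proof.
move=> S1 SM SI.
pose F J := {subset I <= J} /\ forall x, S x -> x \notin J.
have [|Q [IQ SQ] Qmax] := noethA (F := F); first by exists I; split.
exists Q; split=> //; split=> [|x y Qxy]; first exact: SQ.
(* By maximality of Q, the ideal Q + (z) meets S. *)
have meets z : z \notin Q -> exists a s, S s /\ s - a * z \in Q.
  move=> zQ; have [J JP] := ideal_adjoin Q z; apply: contrapT => none.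
  have QJ : {subset Q <= J} by move=> w Qw; apply/JP; exists 0;
    rewrite mul0r subr0.
  have /Qmax/(_ QJ) JQ : F J.
    split=> [w /IQ/QJ//|w Sw]; apply/negP => /JP[a wa].
    by apply: none; exists a, w.
  by move/negP: zQ; apply; apply/JQ/JP; exists 1; rewrite mul1r subrr ideal0.
apply: contrapT => /negP;
  rewrite negb_or => /andP[/meets[a [s [Ss sa]]] /meets[b [t [St tb]]]].
move/negP: (SQ _ (SM _ _ Ss St)); apply.
have -> : s * t = (s - a * x) * t + a * x * (t - b * y) + a * b * (x * y)
  by ring.
by apply: idealD; [apply: idealD|];
  [exact: ideal_mull|exact: ideal_mulr|exact: ideal_mulr].
Qed.

(** The multiplicative set consists of the products s y^m with s outside P: avoiding the s keeps Q
    inside P, and avoiding y itself gives the last claim. *)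
Lemma exists_prime_below I P y : prime_ideal P ->
  (forall m, ~ loc P I (y ^+ m)) ->
  exists Q, [/\ prime_ideal Q, {subset I <= Q}, {subset Q <= P} & y \notin Q].
Proof.
move=> Pp yI; pose S x := exists m, exists2 s : A, s \notin P & x = s * y ^+ m.
have [|_ _ [m [s sP ->]] [l [t tP ->]]|_ [m [s sP ->]]|Q [Qp IQ SQ]] :=
    @exists_prime_disjoint I S.
- by exists 0, 1; rewrite ?mul1r //; case: Pp.
- exists (m + l)%N, (s * t); first exact: prime_mulN.
  by rewrite exprD; ring.
- by apply/negP => sy; apply: (yI m); exists s.
exists Q; split=> // [x Qx|].
  apply: contrapT => /negP xP; move/negP: Qx; apply.
  by apply/negP/SQ; exists 0, x; rewrite ?mulr1.
by apply: SQ; exists 1, 1; rewrite ?mul1r //; case: Pp.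
Qed.

(** This is I A_P = P A_P. If x were not in I A_P, no power of x would be, since I is radical; a
    prime between I and P avoiding x would then contradict minimality. *)
Lemma minimal_prime_loc I P x : radical_ideal I -> minimal_prime I P ->
  x \in P -> loc P I x.
Proof.
move=> Ir [Pp IP Pmin] Px; apply: contrapT => xI.
have [|Q [Qp IQ QP]] := @exists_prime_below I P x Pp.
  move=> m [s sP sx]; apply: xI; exists s => //; case: m sx => [|m sx].
    by rewrite mulr1 => /IP; rewrite (negPf sP).
  by apply: (Ir _ m.+1); rewrite exprMn exprS -mulrA mulrCA ideal_mulr.
by rewrite (Pmin Q).
Qed.

(** A maximal ideal P among the (I : x v) with x v outside I is prime. As I is radical, x v and x
    are not in P; a prime between I and P does not contain x v either, so it contains P. *)
Lemma exists_minimal_prime I x : radical_ideal I -> x \notin I ->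
  exists2 P, minimal_prime I P & x \notin P.
Proof.
move=> Ir xI.
pose F J := exists2 v, x * v \notin I & forall a, a \in J <-> a * (x * v) \in I.
have [|P [v xvI vP] Pmax] := noethA (F := F).
  by have [J JP] := ideal_colon I (x * 1); exists J, 1;
    rewrite ?mulr1 // -[x]mulr1.
have Pxv : x * v \notin P.
  by apply: contra xvI => /vP; rewrite -expr2; apply: Ir.
have IP : {subset I <= P} by move=> a Ia; apply/vP/ideal_mull.
exists P; last first.
  apply: contra xvI => /vP; rewrite mulrA => Ixxv.
  apply: (Ir _ 2); have -> : (x * v) ^+ 2 = x * x * v * v by ring.
  exact: ideal_mull.
split=> // [|Q [_ Qp] IQ QP a /vP/IQ/Qp]; last first.
  by case/orP => // /QP; rewrite (negPf Pxv).
split=> [|a b Pab]; first by apply: contra xvI => /vP; rewrite mul1r.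
have [Pb|bP] := boolP (b \in P); first by rewrite orbT.
rewrite orbF; have [J JP] := ideal_colon I (x * (v * b)).
have bvI : x * (v * b) \notin I by apply: contra bP; rewrite mulrA mulrC => ?;
  apply/vP.
have PJ (c : A) : c \in P -> c \in J.
  move=> /vP Ic; apply/JP.
  have -> : c * (x * (v * b)) = b * (c * (x * v)) by ring.
  exact: ideal_mulr.
apply: (Pmax J) => //; first by exists (v * b).
apply/JP; have -> : a * (x * (v * b)) = a * b * (x * v) by ring.
exact/vP.
Qed.

(** An element of a minimal prime P is killed modulo I by some u outside P. Conversely, if s t is in
    I but t is not, a minimal prime avoiding t must contain s. *)
Lemma nzd_modP I s : radical_ideal I ->
  nzd_mod I s <-> forall P, minimal_prime I P -> s \notin P.
Proof.
move=> Ir; split=> [snzd P Pmin|sP t st].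
  apply/negP => /(minimal_prime_loc Ir Pmin)[u uP us].
  have [_ IP _] := Pmin; move/negP: uP; apply; apply/IP/snzd.
  by rewrite mulrC.
apply: contrapT => /negP /(exists_minimal_prime Ir)[P Pmin tP].
have [Pp IP _] := Pmin.
by move/IP: st; apply/negP; apply: prime_mulN (sP _ Pmin) tP.
Qed.

(** Q is maximal among the ideals (I : b y) contained in P; (I : y) is one of them because y is not
    in I A_P. *)
Lemma exists_associated_prime P I y : prime_ideal P -> ~ loc P I y ->
  exists Q, [/\ associated_prime I Q, {subset Q <= P} &
                forall a, a * y \in I -> a \in Q].
Proof.
move=> Pp yI.
pose F J := {subset J <= P} /\ exists b, forall a,
  a \in J <-> a * (b * y) \in I.
have [|Q [QP [b bQ]] Qmax] := noethA (F := F).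
  have [J JP] := ideal_colon I (1 * y); exists J; split; last by exists 1.
  move=> a /JP; rewrite mul1r => ay; apply: contrapT => /negP aP.
  by apply: yI; exists a.
have Qcolon c J : c \notin Q -> (forall a, a \in J <-> a * (c * b * y) \in I) ->
    {subset J <= P} -> {subset J <= Q}.
  move=> cQ JP subP; apply: Qmax; first by split=> //; exists (c * b).
  move=> a /bQ aby; apply/JP.
  have -> : a * (c * b * y) = c * (a * (b * y)) by ring.
  exact: ideal_mulr.
exists Q; split=> //; last first.
  by move=> a ay; apply/bQ; rewrite mulrCA ideal_mulr.
split; last by exists (b * y) => a; apply/idP/idP => /bQ.
split=> [|u v Quv]; first by apply/negP => /QP; case: Pp => /negPf->.
have [Qu//|uQ /=] := boolP (u \in Q).
have [J JP] := ideal_colon I (u * b * y).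
have vJ : v \in J.
  apply/JP; have -> : v * (u * b * y) = u * v * (b * y) by ring.
  exact/bQ.
(* If s in (I : u b y) were outside P, then u would lie in (I : s b y), which is contained in P and
   hence in Q by maximality. *)
apply: (Qcolon u J) => // s /JP sJ; apply: contrapT => /negP sP.
have [K KP] := ideal_colon I (s * b * y).
have uK : u \in K.
  by apply/KP; have -> : u * (s * b * y) = s * (u * b * y) by ring.
move/negP: uQ; apply; apply: (Qcolon s K) => //.
  by apply: contra sP; apply: QP.
move=> t /KP tK; apply: (prime_cancel Pp sP); apply/QP/bQ.
by have -> : s * t * (b * y) = t * (s * b * y) by ring.
Qed.

(* Take s in J with (I : (I : s)) maximal.  If t s lies in I but t does not,
   pick u in J outside a minimal prime avoiding t: replacing s by s + t u makes
   that ideal larger. *)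
Lemma exists_nzd_mod I J : radical_ideal I ->
  (forall P, minimal_prime I P -> ~ {subset J <= P}) ->
  exists2 s : A, s \in J & nzd_mod I s.
Proof.
move=> Ir JP.
pose F K := exists2 s : A, s \in J &
  forall a, a \in K <-> forall b, s * b \in I -> a * b \in I.
have bicolon s : exists K : ideal A,
    forall a, a \in K <-> forall b, s * b \in I -> a * b \in I.
  apply: ideal_likeP; split=> [b _|x y Ix Iy b sb|a x Ix b sb].
  - by rewrite mul0r ideal0.
  - by rewrite mulrDl idealD ?Ix ?Iy.
  - by rewrite -mulrA ideal_mulr ?Ix.
have [|K [s Js sK] Kmax] := noethA (F := F).
  by have [K KP] := bicolon 0; exists K, 0; rewrite ?ideal0.
exists s => // t st; apply: contrapT => /negP tI.
have [P Pmin tP] := exists_minimal_prime Ir tI; have [Pp IP _] := Pmin.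
have [u Ju uP] : exists2 u : A, u \in J & u \notin P.
  apply: contrapT => none; apply: (JP P Pmin) => u Ju.
  by apply: contrapT => /negP uP; apply: none; exists u.
have [L LP] := bicolon (s + t * u).
(* As s t lies in I, so does the square of t u z, and I is radical. *)
have cancelL z : (s + t * u) * z \in I -> s * z \in I /\ t * u * z \in I.
  move=> Iz; suff tuz : t * u * z \in I.
    split=> //; have -> : s * z = (s + t * u) * z - t * u * z by ring.
    exact: idealB.
  apply: (Ir _ 2); have -> : (t * u * z) ^+ 2
    = (s + t * u) * z * (t * (u * z)) - s * t * (u * z * z) by ring.
  by rewrite idealB // ideal_mull.
have LK : {subset L <= K}.
  apply: Kmax.
    by exists (s + t * u) => //; rewrite idealD 1?ideal_mulr.
  by move=> a /sK aK; apply/LP => b /cancelL[/aK].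
have /LK/sK/(_ _ st) : t * u \in L by apply/LP => b /cancelL[].
by move/IP; apply/negP; rewrite !prime_mulN.
Qed.

(** Without choosing generators of Q: let J be maximal among the ideals that contain I, are
    saturated at Q and do not contain Q. For q in Q outside J, the saturation of J + (q) contains Q,
    so locally Q^2 lies in J + Q q. Then q itself lies in J + Q q locally, which forces q into J. *)
Lemma nakayama_loc Q I : prime_ideal Q ->
  (forall x, x \in Q -> loc Q (ideal_add I (ideal_mul Q Q)) x) ->
  forall x, x \in Q -> loc Q I x.
Proof.
move=> Qp QIQ x0 Qx0; apply: contrapT => x0I.
pose F J := [/\ {subset I <= J}, forall x, loc Q J x -> x \in J &
  ~ {subset Q <= J}].
have sat J : exists K : ideal A, [/\ {subset J <= K},
    forall x, loc Q K x -> x \in K & forall x, x \in K <-> loc Q J x].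
  have [K KP] := ideal_likeP (loc_ideal_like J Qp); exists K; split=> // x.
    by move/(mem_loc Qp)/KP.
  by move/(loc_idem Qp (fun y => (KP y).1))/KP.
have [|J [IJ Jsat QJ] Jmax] := noethA (F := F).
  have [K [IK Ksat KP]] := sat I; exists K; split=> // QK.
  exact/x0I/KP/QK.
have [q Qq qJ] : exists2 q : A, q \in Q & q \notin J.
  apply: contrapT => none; apply: QJ => u Qu.
  by apply: contrapT => /negP uJ; apply: none; exists u.
have [J1 J1P] := ideal_adjoin J q; have [J2 [J12 J2sat J2P]] := sat J1.
have JJ1 : {subset J <= J1}.
  by move=> a Ja; apply/J1P; exists 0; rewrite mul0r subr0.
have qJ1 : q \in J1 by apply/J1P; exists 1; rewrite mul1r subrr ideal0.
have QJ2 : {subset Q <= J2}.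
  apply: contrapT => nQJ2; move/negP: qJ; apply.
  apply: (Jmax J2); last exact: J12.
    by split=> // a /IJ/JJ1/J12.
  by move=> a /JJ1/J12.
(* [S w] says that w lies in J + Q q locally at Q. *)
pose S w := exists s b, [/\ s \notin Q, b \in Q & s * w - b * q \in J].
have Slike : ideal_like S.
  have [Q1 _] := Qp; split=> [|w z [s [b [sQ Qb sb]]] [t [c [tQ Qc tc]]]|].
  - by exists 1, 0; split; rewrite ?ideal0 // mulr0 mul0r subr0 ideal0.
  - exists (s * t), (t * b + s * c); split; first exact: prime_mulN.
      by rewrite idealD 1?ideal_mulr.
    have -> : s * t * (w + z) - (t * b + s * c) * q =
      t * (s * w - b * q) + s * (t * z - c * q) by ring.
    by rewrite idealD 1?ideal_mulr.
  - move=> a w [s [b [sQ Qb sb]]]; exists s, (a * b); split;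
      rewrite 1?ideal_mulr //.
    have -> : s * (a * w) - a * b * q = a * (s * w - b * q) by ring.
    exact: ideal_mulr.
have [s sQ sq] := QIQ q Qq.
have [t [b [tQ Qb]]] : S (s * q).
  apply: (ideal_gen_ind Slike) sq => w [/IJ Jw|].
    exists 1, 0; rewrite ideal0 mul0r subr0 mul1r; split=> //.
    by case: Qp.
  apply: (ideal_gen_ind Slike) => _ [u [v [/QJ2/J2P[c cQ /J1P[a ca]] Qv ->]]].
  exists c, (a * v); split; rewrite 1?ideal_mulr //.
  have -> : c * (u * v) - a * v * q = v * (c * u - a * q) by ring.
  exact: ideal_mulr.
rewrite mulrA -mulrBl => Jtq; move/negP: qJ; apply; apply: Jsat.
by exists (t * s - b) => //; rewrite idealBN // prime_mulN.
Qed.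

End IdealTheory.

Lemma preim_ideal_like (A B : comPzRingType) (phi : {rmorphism A -> B})
  (J : ideal B) : ideal_like (fun a => phi a \in J).
Proof.
split=> [|x y Jx Jy|a x Jx]; rewrite ?rmorph0 ?rmorphD ?rmorphM.
- exact: ideal0.
- exact: idealD.
- exact: ideal_mulr.
Qed.

(** * Noetherian rings *)

(** The maximal condition for objects compared through ideals of A attached to them, such as
    preimages or ideals of leading coefficients. *)
Lemma noetherian_max (A : comPzRingType) (T : Type) (F : T -> Prop)
    (S : T -> A -> Prop) :
  noetherian A -> (forall t, ideal_like (S t)) -> (exists t, F t) ->
  exists2 t, F t &
    forall u, F u -> (forall a, S t a -> S u a) -> forall a, S u a -> S t a.
Proof.
move=> noethA Slike [t0 Ft0].
pose G (I : ideal A) := exists2 t, F t & forall a : A, a \in I <-> S t a.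
have [|I [t Ft It] Imax] := noethA G.
  by have [I0 I0P] := ideal_likeP (Slike t0); exists I0, t0.
exists t => // u Fu tu a Sa; have [J JP] := ideal_likeP (Slike u).
by apply/It/(Imax J); [exists u|move=> b /It/tu/JP|apply/JP].
Qed.

Lemma noetherian_surj (A B : comPzRingType) (phi : {rmorphism A -> B}) :
  (forall b, exists a, phi a = b) -> noetherian A -> noetherian B.
Proof.
move=> phi_surj noethA F F_ex.
have [J FJ Jmax] := noetherian_max noethA (preim_ideal_like phi) F_ex.
exists J => // K FK JK b; have [a <-] := phi_surj b.
by apply: Jmax => // c /JK.
Qed.

Lemma noetherian_field (k : fieldType) : noetherian k.
Proof.
move=> F [I0 FI0];
  (* The unit ideal is maximal if it occurs; otherwise every member of the family is zero. *)
  have [[I [FI I1]]|no1] := pselect (exists I, F I /\ (1 : k) \in I).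
  by exists I => // J _ _ x _; rewrite -[x]mulr1; apply: ideal_mulr.
exists I0 => // J FJ _ x Jx; have [->|x0] := eqVneq (x : k) 0;
  first exact: ideal0.
case: no1; exists J; split=> //.
by rewrite -(mulVf x0); apply: ideal_mulr.
Qed.

(** * Hilbert's basis theorem *)

Section Hilbert.
Variable A : comNzRingType.
Implicit Types (I J : ideal {poly A}) (p q : {poly A}).

(** The ideal of leading coefficients in degree d; the bound on the size lets a be 0. *)
Definition lead I d (a : A) :=
  exists p, [/\ p \in I, (size p <= d.+1)%N & p`_d = a].

Lemma lead_like I d : ideal_like (lead I d).
Proof.
split=> [|a b [p [Ip sp <-]] [q [Iq sq <-]]|c a [p [Ip sp <-]]].
- by exists 0; rewrite ideal0 size_poly0 coef0.
- exists (p + q); rewrite idealD // coefD; split=> //.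
  by rewrite (leq_trans (size_polyD _ _)) // geq_max sp.
- exists (c%:P * p); rewrite ideal_mulr // coefCM; split=> //.
  by rewrite mul_polyC (leq_trans (size_scale_leq _ _)).
Qed.

Lemma lead_sub I J d a : {subset I <= J} -> lead I d a -> lead J d a.
Proof. by move=> IJ [p [/IJ Jp sp <-]]; exists p. Qed.

Lemma lead_leq I d e a : (d <= e)%N -> lead I d a -> lead I e a.
Proof.
move=> de [p [Ip sp <-]]; exists ('X^(e - d) * p); split.
- exact: ideal_mulr.
- by rewrite (leq_trans (size_polyMleq _ _)) // size_polyXn addSn /= -[e in
    leqRHS](subnK de) -addnS leq_add2l.
- by rewrite coefXnM ltnNge leq_subr subKn.
Qed.

(** Induction on the degree: subtracting from p in J an element of I with the same top coefficient
    lowers the degree. *)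
Lemma lead_eq_sub I J : {subset I <= J} ->
  (forall d a, lead J d a -> lead I d a) -> {subset J <= I}.
Proof.
move=> IJ JI p; move: {2}(size p) (leqnn (size p)) => m.
elim: m p => [|m IHm] p; first by rewrite size_poly_leq0 => /eqP -> _;
  apply: ideal0.
move=> sp Jp; have [|q [Iq sq qm]] := JI m p`_m; first by exists p.
rewrite -[p](subrK q) (@idealD _ I) // IHm //; last exact: idealB (IJ _ _).
apply/leq_sizeP => j; rewrite leq_eqVlt => /predU1P[<-|mj].
  by rewrite coefB qm subrr.
by rewrite coefB !nth_default ?subr0 // (leq_trans _ mj).
Qed.

Theorem hilbert_basis : noetherian A -> noetherian {poly A}.
Proof.
move=> noethA F [I0 FI0].
(* The pair (I1, d1) has a maximal leading ideal over all members of F and all degrees, which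
   settles the degrees from d1 on. *)
have [|[I1 d1] /= FI1 I1max] :=
  noetherian_max noethA (fun Id => lead_like Id.1 Id.2)
    (F := fun Id => F Id.1).
  by exists (I0, 0%N).
(* The degrees below d1 are treated one at a time: enlarging the ideal to maximise the next leading
   ideal keeps those already maximised. *)
have [I [FI I1I Imax]] : exists I, [/\ F I, {subset I1 <= I} &
    forall d J, (d < d1)%N -> F J -> {subset I <= J} ->
      forall a, lead J d a -> lead I d a].
  elim: d1 {I1max} => [|e [I [FI I1I Imax]]]; first by exists I1; split.
  have [|J [FJ IJ] Jmax] := noetherian_max noethA (fun J => lead_like J e)
      (F := fun J => F J /\ {subset I <= J}).
    by exists I; split.
  exists J; split=> // [x /I1I/IJ//|d K].
  rewrite ltnS leq_eqVlt => /predU1P[->|de] FK JK a.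
    apply: Jmax => [|b]; last exact: lead_sub.
    by split=> // x /IJ/JK.
  have IK : {subset I <= K} by move=> x /IJ/JK.
  by move=> /(Imax d K de FK IK); apply: lead_sub.
exists I => // J FJ IJ; apply: lead_eq_sub => // d a.
have [dd1|d1d] := ltnP d d1; first exact: Imax.
have I1J : {subset I1 <= J} by move=> x /I1I/IJ.
move=> /(I1max (J, d) FJ) /= I1a; apply/(lead_leq d1d)/(lead_sub I1I)/I1a => b.
by move/(lead_sub I1J)/(lead_leq d1d).
Qed.

End Hilbert.

Lemma mnmBxx n (m : 'X_{1..n}) : (m - m)%MM = 0%MM.
Proof. by apply/mnmP => i; rewrite mnmBE mnm0E subnn. Qed.

(** * Polynomials in n + 1 variables as polynomials in the last variable *)

Section MPolyLastVar.
Variable k : fieldType.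

Lemma mpoly_gen_ind n (S : {mpoly k[n]} -> Prop) :
  (forall c, S c%:MP) -> (forall i, S 'X_i) ->
  (forall p q, S p -> S q -> S (p + q)) ->
  (forall p q, S p -> S q -> S (p * q)) -> forall p, S p.
Proof.
move=> SC SX SD SM; elim/mpolyind => [|c m p _ _ Sp].
  by rewrite -mpolyC0; apply: SC.
apply: (SD) => //; rewrite -mul_mpolyC; apply: (SM) => //; rewrite mpolyXE_id.
apply: big_ind => [||i _]; [by rewrite -mpolyC1|exact: SM|].
elim: (m i) => [|e IHe]; first by rewrite expr0 -mpolyC1.
by rewrite exprS; apply: (SM).
Qed.

Lemma mpoly0E (p : {mpoly k[0]}) : p = (p@_0)%:MP.
Proof.
elim/mpoly_gen_ind: p => [c|[]//|p q Ep Eq|p q -> ->].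
- by rewrite mcoeffC eqxx mulr1.
- by rewrite mcoeffD mpolyCD -Ep -Eq.
- by rewrite -mpolyCM mcoeffC eqxx mulr1.
Qed.

Variable n : nat.

(** The canonical map sending 'X to the last variable. Being surjective, it carries the Noetherian
    property and separation by derivations over to one more variable. *)
Definition poly_mpoly : {rmorphism {poly {mpoly k[n]}} -> {mpoly k[n.+1]}} :=
  horner_eval ('X_ord_max : {mpoly k[n.+1]}) \o map_poly (@mwiden n k).

Lemma poly_mpolyC c : poly_mpoly c%:P = mwiden c.
Proof. by rewrite /= map_polyC horner_evalE hornerC. Qed.

Lemma poly_mpolyX : poly_mpoly 'X = 'X_ord_max.
Proof. by rewrite /= map_polyX horner_evalE hornerX. Qed.

Lemma mwiden_var (i : 'I_n) : mwiden ('X_i : {mpoly k[n]}) = 'X_(lift ord_max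
  i).
Proof.
rewrite mwidenX mnmwiden1; congr ('X_[U_(_)]); apply: val_inj => /=.
by rewrite /bump leqNgt ltn_ord.
Qed.

Lemma poly_mpoly_surj q : exists p, poly_mpoly p = q.
Proof.
elim/mpoly_gen_ind: q => [c|i|p q [p' <-] [q' <-]|p q [p' <-] [q' <-]].
- by exists (c%:MP)%:P; rewrite poly_mpolyC mwidenC.
- have [j ->|->] := unliftP ord_max i; last by exists 'X; apply: poly_mpolyX.
  by exists ('X_j)%:P; rewrite poly_mpolyC mwiden_var.
- by exists (p' + q'); rewrite rmorphD.
- by exists (p' * q'); rewrite rmorphM.
Qed.

Lemma mderiv_mwiden (i : 'I_n.+1) (p : {mpoly k[n]}) :
  mderiv i (mwiden p) = if unlift ord_max i is Some j then mwiden (mderiv j p)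
    else 0.
Proof.
elim/mpoly_gen_ind: p => [c|l|p q Ep Eq|p q Ep Eq].
- by rewrite mwidenC mderivC; case: unliftP => // j _; rewrite mderivC mwiden0.
- rewrite mwiden_var mderivX mnm1E; case: unliftP => [j ->|->].
    rewrite (inj_eq (@lift_inj _ _)) mderivX mnm1E mwidenZ mwidenX.
    have [->|_] := eqVneq; last by rewrite !scale0r.
    by rewrite !mnmBxx mnmwiden0.
  by rewrite eq_sym (negPf (neq_lift _ _)) scale0r.
- rewrite mwidenD mderivD Ep Eq; case: unliftP => [j _|_];
    last by rewrite addr0.
  by rewrite mderivD mwidenD.
- rewrite mwidenM mderivM Ep Eq; case: unliftP => [j _|_];
    last by rewrite mul0r mulr0 addr0.
  by rewrite mderivM mwidenD !mwidenM.
Qed.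

End MPolyLastVar.

Lemma noetherian_mpoly (k : fieldType) n : noetherian {mpoly k[n]}.
Proof.
elim: n => [|n IHn];
  last exact: noetherian_surj (@poly_mpoly_surj k n) (hilbert_basis IHn).
apply: (noetherian_surj (phi := @mpolyC 0 k)) (@noetherian_field k) => p.
by exists p@_0; apply/esym/mpoly0E.
Qed.

(** * Derivations, heights and squares of primes *)

Section DerivationTheory.
Variable A : comPzRingType.
Implicit Types (I J P Q : ideal A) (a b s t u v x y : A) (D : A -> A).

(** No base field is involved; [der_linear] recovers linearity over k. *)
Definition is_der D := {morph D : x y / x + y} /\
  forall x y, D (x * y) = x * D y + D x * y.

Lemma der0 D : is_der D -> D 0 = 0.
Proof. by case=> DD _; apply: (addIr (D 0)); rewrite -DD !add0r. Qed.

Lemma derX D x m : is_der D -> D (x ^+ m.+1) = (m.+1%:R * x ^+ m) * D x.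
Proof.
move=> [_ DM]; elim: m => [|m IHm]; first by rewrite expr1 expr0 mulr1 mul1r.
by rewrite exprS DM IHm -natr1 exprS; ring.
Qed.

(** Says that A is an algebra over the rational numbers. *)
Definition char0 := forall m, exists u, u * m.+1%:R = 1.

Lemma char0_prime P m : char0 -> prime_ideal P -> m.+1%:R \notin P.
Proof.
move=> /(_ m)[u um] [P1 _]; apply: contra P1 => Pm.
by rewrite -um; apply: ideal_mulr.
Qed.

(** Applying D to s x^(m+1) in I gives ((m+1) s D x + x D s) x^m in I, whose first factor is again
    outside Q, so the exponent descends to 0. *)
Lemma der_not_nilpotent Q I D x m : char0 -> prime_ideal Q -> is_der D ->
  {subset I <= Q} -> (forall y, y \in I -> D y \in I) ->
  x \in Q -> D x \notin Q -> ~ loc Q I (x ^+ m).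
Proof.
move=> A0 Qp Dder IQ DI Qx Dx; elim: m => [|m IHm] [s sQ].
  by rewrite expr0 mulr1 => /IQ; rewrite (negPf sQ).
move=> Isx; apply: IHm; exists (m.+1%:R * s * D x + x * D s).
  rewrite -(opprK (x * D s)) idealBN // ?prime_mulN ?char0_prime //.
  by rewrite -mulrN ideal_mull.
have -> : (m.+1%:R * s * D x + x * D s) * x ^+ m = D (s * x ^+ m.+1).
  by rewrite Dder.2 derX // exprS; ring.
exact: DI.
Qed.

Lemma der_ideal_gen S D : is_der D -> (forall x, S x -> D x \in ideal_gen S) ->
  forall x, x \in ideal_gen S -> D x \in ideal_gen S.
Proof.
move=> Dder DS x Sx; have [DD DM] := Dder.
pose S' y := y \in ideal_gen S /\ D y \in ideal_gen S.
suff: S' x by case.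
apply: (ideal_gen_ind (S' := S')) Sx => [|y Sy]; last first.
  by split; [apply: mem_ideal_gen|apply: DS].
split=> [|y z [Sy SDy] [Sz SDz]|a y [Sy SDy]].
- by split; rewrite ?(der0 Dder) ideal0.
- by split; rewrite ?DD idealD.
- split; first exact: ideal_mulr.
  by rewrite DM; apply: idealD; [apply: ideal_mulr|apply: ideal_mulr].
Qed.

Lemma prime_height_ge_step P Q m : prime_ideal Q -> {subset P <= Q} ->
  ~ {subset Q <= P} -> prime_height_ge P m -> prime_height_ge Q m.+1.
Proof.
move=> Qp PQ nQP [c [cp cs cm]].
exists (fun i => if (i <= m)%N then c i else Q); split=> [i _|i|x].
- by case: ifP => // /cp.
- rewrite ltnS; case: ltngtP => // [im _|-> _]; last first.
    split=> [x|Qc]; first by rewrite cm => /PQ.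
    by apply: nQP => x /Qc; rewrite cm.
  exact: cs.
- by rewrite ltnn.
Qed.

Lemma prime_height_ge_sub P Q m : prime_ideal Q -> {subset P <= Q} ->
  prime_height_ge P m -> prime_height_ge Q m.
Proof.
move=> Qp PQ; case: m => [|m] [c [cp cs cm]].
  by exists (fun=> Q); split.
have [cle cne] := cs m (leqnn _).
apply: (@prime_height_ge_step (c m)) => // [x /cle|Qc|].
- by rewrite cm => /PQ.
- by apply: cne => x; rewrite cm => /PQ/Qc.
by exists c; split=> // i im; [apply/cp/leqW|apply/cs/leqW].
Qed.

(** The matrix of the D_i f_j is triangular with diagonal outside Q. The last D preserves the ideal
    of the earlier f_j, so no power of the last f lies in that ideal locally at Q. Some prime P
    inside Q thus contains the earlier f_j but not the last one, and induction applies to P. *)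
Lemma prime_height_ge_der Q m (f : nat -> A) (D : nat -> A -> A) :
  noetherian A -> char0 -> prime_ideal Q ->
  (forall i, (i < m)%N -> f i \in Q) -> (forall i, (i < m)%N -> is_der (D i)) ->
  (forall i, (i < m)%N -> D i (f i) \notin Q) ->
  (forall i j, (i < m)%N -> (j < i)%N -> D i (f j) = 0) ->
  prime_height_ge Q m.
Proof.
move=> noethA A0; elim: m Q => [|m IHm] Q Qp fQ Dder Df Df0.
  by exists (fun=> Q); split.
pose S x := exists2 i, (i < m)%N & x = f i.
have SQ : {subset ideal_gen S <= Q}.
  by apply: ideal_gen_sub => _ [i im ->]; apply/fQ/leqW.
have DS x : x \in ideal_gen S -> D m x \in ideal_gen S.
  apply: der_ideal_gen => [|_ [i im ->]]; first exact: Dder.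
  by rewrite Df0 // ideal0.
have Dfm e : ~ loc Q (ideal_gen S) (f m ^+ e).
  by apply: (der_not_nilpotent A0 Qp (Dder m _)) => //; [apply: fQ|apply: Df].
have [P [Pp SP PQ fmP]] := exists_prime_below noethA Qp Dfm.
apply: (prime_height_ge_step Qp PQ) => [QP|]; first by rewrite QP ?fQ in fmP.
apply: IHm => // [i im|i im|i im|i j im ji].
- by apply/SP/mem_ideal_gen; exists i.
- exact/Dder/leqW.
- by apply: contra (Df i (leqW im)); apply: PQ.
- by apply: Df0 => //; apply: leqW.
Qed.

(* P^2 A_P is cut out of P A_P by the derivations in DD. *)
Definition der_separated (DD : (A -> A) -> Prop) := forall P x,
  prime_ideal P -> x \in P -> (forall D, DD D -> D x \in P) ->
  loc P (ideal_mul P P) x.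

End DerivationTheory.

(** The preimage of P is a prime of A, and each D in DA induces some E in DB, so the criterion in A
    applies to a lift of x. *)
Lemma der_separated_surj (A B : comPzRingType) (phi : {rmorphism A ->
  B}) DA DB :
  (forall b, exists a, phi a = b) ->
  (forall D, DA D -> exists2 E, DB E & forall a, phi (D a) = E (phi a)) ->
  der_separated DA -> der_separated DB.
Proof.
move=> phi_surj DAB sepA P x Pp Px DBx.
have [a ax] := phi_surj x.
have [Q QP] := ideal_likeP (preim_ideal_like phi P).
have Qp : prime_ideal Q.
  split=> [|u v /QP]; first by apply/negP => /QP; rewrite rmorph1;
    case: Pp => /negPf->.
  by rewrite rmorphM => /(proj2 Pp)/orP[] /QP->; rewrite ?orbT.
have [|D DAD|s sQ sa] := sepA Q a Qp; first by apply/QP; rewrite ax.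
  by have [E DBE DE] := DAB D DAD; apply/QP; rewrite DE ax; apply: DBx.
exists (phi s); first by apply: contra sQ => /QP.
rewrite -ax -rmorphM; move: (s * a) sa.
apply: (ideal_gen_ind (preim_ideal_like phi _)) => _ [u [v [/QP Pu /QP Pv ->]]].
by rewrite rmorphM; apply: mem_ideal_mul.
Qed.

(** * Separation by derivations passes from A to A[X] *)

Section PolySeparated.
Variable A : comNzRingType.
Variable DD : (A -> A) -> Prop.
Hypotheses (A0 : char0 A) (DDder : forall D, DD D -> is_der D).
Hypothesis sepA : der_separated DD.

Definition poly_ders (E : {poly A} -> {poly A}) :=
  (exists2 D, DD D & E = map_poly D) \/ E = @deriv A.

Lemma map_poly_der (D : A -> A) : is_der D -> is_der (map_poly D : {poly A} ->
  {poly A}).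
Proof.
move=> Dder; have D0 := der0 Dder; have [DD' DM] := Dder.
split=> p q; apply/polyP => i.
  by rewrite coefD !coef_map_id0 // coefD DD'.
rewrite coefD !coefM coef_map_id0 // coefM.
rewrite (big_morph D DD' D0) -big_split; apply: eq_bigr => j _ /=.
by rewrite !coef_map_id0 // DM.
Qed.

Lemma poly_ders_der (E : {poly A} -> {poly A}) : poly_ders E -> is_der E.
Proof.
case=> [[D /DDder Dder ->]|->]; first exact: map_poly_der.
by split=> p q; rewrite ?derivD // derivM addrC.
Qed.

Section Prime.
Variable P : ideal {poly A}.
Hypothesis Pp : prime_ideal P.

Lemma const_prime : exists2 P0 : ideal A, prime_ideal P0 &
  forall a, a \in P0 <-> a%:P \in P.
Proof.
have [P0 P0P] : exists P0 : ideal A, forall a, a \in P0 <-> a%:P \in P.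
  exact: ideal_likeP (preim_ideal_like (@polyC A) P).
exists P0 => //; have [P1 PM] := Pp; split=> [|a b /P0P].
  by apply: contra P1 => /P0P.
by rewrite polyCM => /PM/orP[] /P0P->; rewrite ?orbT.
Qed.

(** The criterion in A applies to each coefficient of F at the prime P \cap A. *)
Lemma loc_coef (F : {poly A}) : (forall i, (F`_i)%:P \in P) ->
  (forall D i, DD D -> (D F`_i)%:P \in P) -> loc P (ideal_mul P P) F.
Proof.
have [P0 P0p P0P] := const_prime.
move=> PF PDF; have [l0 lD lM] := loc_ideal_like (ideal_mul P P) Pp.
rewrite -[F]coefK poly_def; apply: (big_ind (loc P (ideal_mul P P))) => // i _.
rewrite -mul_polyC mulrC; apply: (lM).
have [|D DDD|s sP0 sF] := sepA P0p (x := F`_i); first exact/P0P.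
  exact/P0P/PDF.
exists s%:P; first by apply: contra sP0 => /P0P.
rewrite -polyCM; move: (s * F`_i) sF.
apply: (ideal_gen_ind (preim_ideal_like (@polyC A) _)) =>
  _ [u [v [/P0P Pu /P0P Pv ->]]].
by rewrite rmorphM; apply: mem_ideal_mul.
Qed.

(* G has minimal degree among the elements of P with a coefficient outside
   P \cap A, so its derivative is not in P.  Pseudo-division by G leaves a
   remainder with all its coefficients in P and a quotient in P. *)
Lemma loc_minimal (G : {poly A}) i0 : G \in P -> (G`_i0)%:P \notin P ->
  (forall H i, H \in P -> (size H < size G)%N -> (H`_i)%:P \in P) ->
  forall F, F \in P -> (forall E, poly_ders E -> E F \in P) ->
  loc P (ideal_mul P P) F.
Proof.
move=> PG Gi0 Gmin F PF EF; have [P0 P0p P0P] := const_prime.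
have [l0 lD lM] := loc_ideal_like (ideal_mul P P) Pp.
have G0 : G != 0 by apply: contra Gi0 => /eqP->; rewrite coef0 ideal0.
pose c := lead_coef G; pose d := (size G).-1.
have sizeG : size G = d.+1 by rewrite /d polySpred.
(* Otherwise G minus its leading term would be an element of P of smaller degree, and all
   coefficients of G would lie in P. *)
have cP : c%:P \notin P.
  apply: contra Gi0 => Pc.
  have -> : G`_i0 = (G - c%:P * 'X^d)`_i0 + c * (i0 == d)%:R.
    by rewrite coefB coefCM coefXn subrK.
  rewrite polyCD polyCM; apply: idealD; last exact: ideal_mull.
  apply: Gmin; first by apply: idealB => //; apply: ideal_mull.
  rewrite sizeG ltnS; apply/leq_sizeP => j;
    rewrite leq_eqVlt coefB coefCM coefXn.
  move=> /predU1P[<-|dj]; first by rewrite eqxx mulr1 subrr.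
  by rewrite (gtn_eqF dj) mulr0 subr0 nth_default // sizeG.
(* If d = 0, then G is the constant c, which is impossible. Otherwise the top coefficient d c of the
   derivative is outside P by characteristic 0, against the minimality of G. *)
have dG : deriv G \notin P.
  case Ed: d sizeG => [|e] sizeG.
    have := cP; rewrite /c; move: sizeG => /eqP/size_poly1P[a a0 Ga].
    by rewrite Ga lead_coefC -Ga PG.
  have cn : (c *+ e.+1)%:P \notin P.
    rewrite -mulr_natr polyCM prime_mulN //.
    by apply: contra (char0_prime e A0 P0p) => /P0P.
  apply: contra cn => PdG.
  have := Gmin (deriv G) e PdG (lt_size_deriv G0).
  by rewrite coef_deriv /c lead_coefE -/d Ed.
pose m := Pdiv.CommonRing.rscalp F G; pose q := Pdiv.CommonRing.rdivp F G.
pose R := Pdiv.CommonRing.rmodp F G.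
have FR : R = c%:P ^+ m * F - q * G.
  apply/esym/eqP; rewrite subr_eq addrC -polyC_exp mulrC.
  exact/eqP/Pdiv.RingComRreg.rdivp_eq/mulrC.
have sizeR : (size R < size G)%N by exact: Pdiv.CommonRing.ltn_rmodpN0.
have PcF : c%:P ^+ m * F \in P by apply: ideal_mulr.
have EcF E : poly_ders E -> E (c%:P ^+ m * F) \in P.
  move=> PE; rewrite (poly_ders_der PE).2; apply: idealD;
    last exact: ideal_mulr.
  by apply/ideal_mulr/EF.
have PR : R \in P by rewrite FR; apply: idealB => //; apply: ideal_mulr.
(* Differentiate c^m F = R + q G: every term other than G' q lies in P, and G' does not. *)
have Pq : q \in P.
  apply: (prime_cancel Pp dG).
  have -> : deriv G * q = deriv (c%:P ^+ m * F) - deriv R - deriv q * G.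
    by rewrite FR derivB (derivM q G); ring.
  apply: idealB; last exact: ideal_mulr.
  apply: idealB; first by apply: EcF; right.
  have sizedR : (size (deriv R) < size G)%N.
    have [->|R0] := eqVneq R 0; first by rewrite deriv0 size_poly0 sizeG.
    exact: ltn_trans (lt_size_deriv R0) sizeR.
  rewrite -[deriv R]coefK poly_def; apply: ideal_sum => i _.
  rewrite -mul_polyC; apply: ideal_mull; rewrite coef_deriv -mulr_natr polyCM.
  exact/ideal_mull/Gmin.
(* Modulo P the polynomial D R agrees with D (c^m F), and it is shorter than G, so its coefficients
   lie in P. *)
have lR : loc P (ideal_mul P P) R.
  apply: loc_coef => [i|D i DDD]; first exact: Gmin.
  have Dder := DDder DDD; have Eder := map_poly_der Dder.
  rewrite -(coef_map_id0 _ _ (der0 Dder)); apply: Gmin.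
    have := EcF (map_poly D);
      have -> : c%:P ^+ m * F = R + q * G by rewrite FR subrK.
    rewrite Eder.1 Eder.2 => PE.
    have -> : map_poly D R = map_poly D R + (q * map_poly D G + map_poly D q *
      G) - (q * map_poly D G + map_poly D q * G) by rewrite addrK.
    apply: idealB; first by apply: PE; left; exists D.
    by apply: idealD; [apply: ideal_mull|apply: ideal_mulr].
  exact: leq_ltn_trans (size_poly _ _) sizeR.
apply: (loc_cancel Pp (prime_expN m Pp cP)).
have -> : c%:P ^+ m * F = R + q * G by rewrite FR subrK.
by apply: lD => //; apply/(mem_loc Pp)/mem_ideal_mul.
Qed.

End Prime.

(** Either some element of P has a coefficient outside P, and one of least degree is used for
    pseudo-division, or P is extended from P \cap A. *)
Lemma der_separated_poly : der_separated poly_ders.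
Proof.
move=> P F Pp PF EF.
pose bad m := `[< exists G i, [/\ G \in P, (G`_i)%:P \notin P & size G = m] >].
have [ex_bad|no_bad] := pselect (exists m, bad m).
  case: (ex_minnP ex_bad) => _ /asboolP[G [i [PG Gi <-]]] Gmin.
  apply: (loc_minimal Pp PG Gi) => // H j PH HG; apply: contrapT => /negP Hj.
  have : bad (size H) by apply/asboolP; exists H, j.
  by move/Gmin; rewrite leqNgt HG.
have coefP G i : G \in P -> (G`_i)%:P \in P.
  move=> PG; apply: contrapT => /negP Gi; apply: no_bad; exists (size G).
  by apply/asboolP; exists G, i.
apply: loc_coef => // [i|D i DDD]; first exact: coefP.
rewrite -(coef_map_id0 _ _ (der0 (DDder DDD))); apply: coefP.
by apply: EF; left; exists D.
Qed.

End PolySeparated.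

(** * The Jacobian criterion *)

Lemma mderiv_der (k : fieldType) n (i : 'I_n) : is_der (@mderiv n k i).
Proof. by split=> p q; rewrite ?mderivD // mderivM addrC. Qed.

Definition mpoly_ders (k : fieldType) n (D : {mpoly k[n]} -> {mpoly k[n]}) :=
  exists i, D = mderiv i.

Lemma poly_mpolyMXaddC (k : fieldType) n (p : {poly {mpoly k[n]}}) c :
  poly_mpoly k n (p * 'X + c%:P) = poly_mpoly k n p * 'X_ord_max + mwiden c.
Proof. by rewrite rmorphD rmorphM poly_mpolyX poly_mpolyC. Qed.

Lemma poly_mpoly_deriv (k : fieldType) n (p : {poly {mpoly k[n]}}) :
  poly_mpoly k n p^`() = mderiv ord_max (poly_mpoly k n p).
Proof.
elim/poly_ind: p => [|p c IHp]; first by rewrite deriv0 !rmorph0 mderiv0.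
rewrite derivD derivM derivX derivC mulr1 addr0 !rmorphD !rmorphM IHp.
rewrite poly_mpolyX poly_mpolyC mderivD mderivM mderiv_mwiden unlift_none addr0.
by rewrite mderivX mnm1E eqxx scale1r mnmBxx mpolyX0 mulr1.
Qed.

Lemma poly_mpoly_map_deriv (k : fieldType) n (i : 'I_n) (p : {poly {mpoly
  k[n]}}) :
  poly_mpoly k n (map_poly (mderiv i) p) =
  mderiv (lift ord_max i) (poly_mpoly k n p).
Proof.
have ED q q' : map_poly (mderiv i) (q + q') =
    map_poly (mderiv i) q + map_poly (mderiv i) q' :> {poly {mpoly k[n]}}.
  exact: (map_poly_der (mderiv_der k i)).1.
have EM q q' : map_poly (mderiv i) (q * q') =
    q * map_poly (mderiv i) q' + map_poly (mderiv i) q * q' :> {poly {mpoly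
      k[n]}}.
  exact: (map_poly_der (mderiv_der k i)).2.
elim/poly_ind: p => [|p c IHp].
  by rewrite (der0 (map_poly_der (mderiv_der k i))) !rmorph0 mderiv0.
rewrite ED EM map_polyC (_ : map_poly _ 'X = 0); last first.
  apply/polyP => j; rewrite coef_map_id0 ?mderiv0 // coefX coef0.
  by case: eqP; rewrite ?mderiv0 // -mpolyC1 mderivC.
rewrite mulr0 add0r; apply: (etrans (poly_mpolyMXaddC _ _)).
apply/esym; apply: (etrans (congr1 _ (poly_mpolyMXaddC _ _))).
rewrite mderivD mderivM mderiv_mwiden liftK mderivX mnm1E.
by rewrite (negPf (neq_lift _ _)) scale0r mulr0 addr0 IHp.
Qed.

(** * Derivations of polynomial rings in characteristic 0 *)

Section MPolyDerivations.
Variable k : fieldType.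
Hypothesis char_k : [pchar k] =i pred0.

Lemma mpoly_char0 n : char0 {mpoly k[n]}.
Proof.
move=> m; exists (m.+1%:R^-1)%:MP;
  rewrite -mpolyC_nat -mpolyCM mulVf ?mpolyC1 //.
by move/pcharf0P: char_k => ->.
Qed.

Lemma mpoly_der_separated n : der_separated (@mpoly_ders k n).
Proof.
elim: n => [|n IHn] .
  (* With no variables the ring is k, whose only prime is 0. *)
  move=> P x [P1 _] Px _; suff -> : x = 0 by exists 1; rewrite ?mulr0 ?ideal0.
  have xC := mpoly0E x.
  rewrite xC; have [->|x0] := eqVneq x@_0 0; first by rewrite mpolyC0.
  move: P1; rewrite -mpolyC1 -(mulVf x0) mpolyCM -xC.
  by rewrite ideal_mulr.
apply: (der_separated_surj (@poly_mpoly_surj k n)) (der_separated_poly _ _ IHn).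
- move=> E [[_ [i ->] ->]|->].
    by exists (mderiv (lift ord_max i)) => [|p];
      [exists (lift ord_max i)|exact: poly_mpoly_map_deriv].
  by exists (mderiv ord_max) => [|p]; [exists ord_max|exact: poly_mpoly_deriv].
- exact: mpoly_char0.
- by move=> _ [i ->]; apply: mderiv_der.
Qed.

Lemma der_linear n (D : {mpoly k[n]} -> {mpoly k[n]}) :
  is_der D -> (forall c, D c%:MP = 0) -> linear D.
Proof.
by move=> [DD DM] DC a p q; rewrite DD -!mul_mpolyC DM DC mul0r addr0.
Qed.

Lemma scale_der n (a : {mpoly k[n]}) D : is_der D -> is_der (fun x => a * D x).
Proof. by move=> [DD DM]; split=> x y; rewrite ?DD ?DM; ring. Qed.

(** * Derivations attached to a minor of the Jacobian matrix *)

Section Jacobian.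
Variables (n p : nat) (F : 'I_p -> {mpoly k[n]}) (t : 'I_p -> 'I_n).
Implicit Types (x y : {mpoly k[n]}) (Q h : ideal {mpoly k[n]}).

Definition jac_mx := \matrix_(i < p, j < p) mderiv (t j) (F i).
Definition jac_det := \det jac_mx.

(* By Cramer's rule [dual_der i] sends F i to the minor jac_det and kills the
   other F j, so that [ker_der l] kills all of them. *)
Definition dual_der i x := \sum_j \adj jac_mx j i * mderiv (t j) x.
Definition ker_der l x :=
  jac_det * mderiv l x - \sum_i mderiv l (F i) * dual_der i x.

Lemma dual_der_der i : is_der (dual_der i).
Proof.
split=> x y; rewrite /dual_der.
  by rewrite -big_split; apply: eq_bigr => j _ /=; rewrite mderivD mulrDr.
rewrite mulr_sumr mulr_suml -big_split; apply: eq_bigr => j _ /=.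
by rewrite mderivM; ring.
Qed.

Lemma dual_derE i j : dual_der i (F j) = jac_det *+ (j == i).
Proof.
have /matrixP/(_ j i) := mul_mx_adj jac_mx; rewrite !mxE => <-.
by apply: eq_bigr => l _; rewrite !mxE mulrC.
Qed.

Lemma ker_der_der l : is_der (ker_der l).
Proof.
split=> x y; rewrite /ker_der.
  rewrite mderivD (eq_bigr (fun i =>
    mderiv l (F i) * dual_der i x + mderiv l (F i) * dual_der i y)).
    by rewrite big_split /=; ring.
  by move=> i _; rewrite (dual_der_der i).1 mulrDr.
rewrite mderivM (eq_bigr (fun i =>
  x * (mderiv l (F i) * dual_der i y) + mderiv l (F i) * dual_der i x * y)).
  by rewrite big_split /= -mulr_sumr -mulr_suml; ring.
by move=> i _; rewrite (dual_der_der i).2; ring.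
Qed.

Lemma ker_derE l j : ker_der l (F j) = 0.
Proof.
rewrite /ker_der (bigD1 j) //= dual_derE eqxx mulr1n big1 => [|i ij].
  by rewrite addr0 mulrC subrr.
by rewrite dual_derE eq_sym (negPf ij) mulr0n mulr0.
Qed.

Lemma ker_derC l c : ker_der l c%:MP = 0.
Proof.
rewrite /ker_der mderivC mulr0 big1 ?subr0 // => i _.
by rewrite /dual_der big1 ?mulr0 // => j _; rewrite mderivC mulr0.
Qed.

(** Let y be the sum of the [dual_der i x * F i], an element of h. Modulo Q, the l-th partial
    derivative of [jac_det * x - y] is [ker_der l x], so this difference is in Q^2 locally, and the
    minor is a unit at Q. *)
Lemma loc_square_of_ker_der Q h x :
  prime_ideal Q -> jac_det \notin Q -> {subset h <= Q} -> (forall i,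
    F i \in h) ->
  x \in Q -> (forall l, ker_der l x \in Q) ->
  loc Q (ideal_add h (ideal_mul Q Q)) x.
Proof.
move=> Qp detQ hQ Fh Qx kerx; have FQ i : F i \in Q := hQ _ (Fh i).
pose y := \sum_i dual_der i x * F i.
have yh : y \in h by apply: ideal_sum => i _; apply: ideal_mulr.
have : loc Q (ideal_mul Q Q) (jac_det * x - y).
  apply: (mpoly_der_separated Qp) => [|_ [l ->]].
    by apply: idealB; [apply: ideal_mulr|apply: hQ].
  have -> : mderiv l (jac_det * x - y) = mderiv l jac_det * x + ker_der l x
      - \sum_i mderiv l (dual_der i x) * F i.
    rewrite mderivB mderivM;
      have -> : mderiv l y = \sum_i mderiv l (F i) * dual_der i x
        + \sum_i mderiv l (dual_der i x) * F i.
      rewrite raddf_sum -big_split; apply: eq_bigr => i _ /=.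
      by rewrite mderivM; ring.
    by rewrite /ker_der; ring.
  apply: idealB; first by apply: idealD => //; apply: ideal_mulr.
  by apply: ideal_sum => i _; apply: ideal_mulr.
move/(loc_sub (fun _ => id) (@mem_ideal_addr _ h (ideal_mul Q Q))) => lxy.
apply: (loc_cancel Qp detQ); rewrite -[_ * x](subrK y).
have [_ lD _] := loc_ideal_like (ideal_add h (ideal_mul Q Q)) Qp.
by apply: (lD) => //; apply/(mem_loc Qp)/mem_ideal_addl.
Qed.

(** The elements F_1, ..., F_p, x with the derivations [dual_der] followed by [ker_der l] form a
    triangular system of length p + 1; index p falls to the default of [insub]. *)
Lemma ker_der_height Q x l :
  prime_ideal Q -> jac_det \notin Q -> (forall i, F i \in Q) ->
  x \in Q -> ker_der l x \notin Q -> prime_height_ge Q p.+1.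
Proof.
move=> Qp detQ FQ Qx kerx.
pose f i := if insub i is Some j then F j else x.
pose D i := if insub i is Some j then dual_der j else ker_der l.
apply: (@prime_height_ge_der _ _ _ f D (@noetherian_mpoly k n) (mpoly_char0 n))
  => //.
- by rewrite /f => i _; case: insubP.
- by move=> i _; rewrite /D; case: insubP => [j _ _|_];
    [apply: dual_der_der|apply: ker_der_der].
- move=> i _; rewrite /f /D; case: insubP => [j _ _|//].
  by rewrite dual_derE eqxx.
- move=> i j; rewrite ltnS /f /D => ip ji.
  rewrite (insubT (fun m => m < p)%N (leq_trans ji ip)) /=.
  case: insubP => [u _ ui|_]; last exact: ker_derE.
  rewrite dual_derE (negPf (_ : _ != _)) // -val_eqE /= ui.
  by rewrite (ltn_eqF ji).
Qed.

(** The height bound makes every [ker_der m] preserve Q. Hence Q lies in (F) + Q^2 locally, and in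
    (F) by Nakayama. So s y is in (F) for some s outside Q, and [ker_der l] preserves (F); the
    Leibniz rule does the rest. *)
Lemma ker_der_loc Q h l y : 
  prime_ideal Q -> jac_det \notin Q -> {subset h <= Q} -> (forall i,
    F i \in h) ->
  ~ prime_height_ge Q p.+1 -> y \in h -> loc Q h (ker_der l y).
Proof.
move=> Qp detQ hQ Fh Qht hy.
pose I := ideal_gen (fun z => exists i, z = F i).
have IF i : F i \in I by apply: mem_ideal_gen; exists i.
have Ih : {subset I <= h} by apply: ideal_gen_sub => _ [i ->].
have FQ i : F i \in Q := hQ _ (Fh i).
have kerQ m x : x \in Q -> ker_der m x \in Q.
  by move=> Qx; apply: contrapT => /negP /(ker_der_height Qp detQ FQ Qx).
have [s sQ sy] : loc Q I y.
  apply: (nakayama_loc (@noetherian_mpoly k n) Qp) (hQ _ hy) => x Qx.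
  by apply: loc_square_of_ker_der => // [z /Ih/hQ|m] //; apply: kerQ.
have /(der_ideal_gen (ker_der_der l)) kerI z :
    (exists i, z = F i) -> ker_der l z \in I.
  by move=> [i ->]; rewrite ker_derE ideal0.
exists s => //; have /Ih := kerI _ sy; rewrite (ker_der_der l).2 => hsy.
rewrite -[s * _](addrK (ker_der l s * y)); apply: idealB => //.
exact: ideal_mulr.
Qed.

End Jacobian.
End MPolyDerivations.

(** * Torsion of the conormal module *)

(** Turns a linear functional graph into a map. The maps between subquotients are given on
    representatives that carry membership proofs, and a graph avoids choosing these. *)
Lemma linear_of_rel (R : pzRingType) (U V : lmodType R) (rho : U -> V -> Prop) :
  (forall u, exists v, rho u v) ->
  (forall u v w, rho u v -> rho u w -> v = w) ->
  (forall a u u' v v',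
    rho u v -> rho u' v' -> rho (a *: u + u') (a *: v + v')) ->
  exists f : {linear U -> V}, forall u, rho u (f u).
Proof.
move=> /choice[f fP] rho_fun rho_lin.
have f_lin : linear f by move=> a u u'; apply: (rho_fun _ _ _ (fP _));
  apply: rho_lin.
pose F : {linear U -> V} := HB.pack f (GRing.isLinear.Build R U V _ f f_lin).
by exists F.
Qed.

Lemma inj_surj_bij (U V : Type) (f : U -> V) :
  injective f -> (forall v, exists u, f u = v) -> bijective f.
Proof.
by move=> f_inj /choice[g fg]; exists g => // u; apply: f_inj.
Qed.

(** * Calculation with classes in subquotients *)

Section SubquotientClasses.
Variables (A : pzRingType) (V : lmodType A) (J I : submodClosed V).

Lemma sqcls_eqP x y (Jx : x \in J) (Jy : y \in J) :
  sqcls I Jx = sqcls I Jy <-> x - y \in I.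
Proof.
split=> [/mproj_eqP/asboolW|xy]; first by [].
by apply/mproj_eqP/asboolT.
Qed.

Lemma sqcls_surj (u : subquo J I) : exists x (Jx : x \in J), u = sqcls I Jx.
Proof.
exists (val (repr u)), (valP (repr u)).
by rewrite -[LHS]reprK /sqcls; congr (mproj _ _); apply: val_inj.
Qed.

Lemma sqcls_lin a x y (Jx : x \in J) (Jy : y \in J) (Jxy : a *: x + y \in J) :
  a *: sqcls I Jx + sqcls I Jy = sqcls I Jxy.
Proof.
rewrite /sqcls -linearP; congr (mproj _ _).
by apply: val_inj; rewrite linearP.
Qed.

Lemma sqcls_scale a x (Jx : x \in J) (Jax : a *: x \in J) :
  a *: sqcls I Jx = sqcls I Jax.
Proof.
rewrite /sqcls -linearZ; congr (mproj _ _).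
by apply: val_inj; rewrite linearZ.
Qed.

Lemma sqcls_eq0 x (Jx : x \in J) : sqcls I Jx = 0 <-> x \in I.
Proof.
have -> : 0 = sqcls I (rpred0 J).
  rewrite /sqcls (_ : SubmodOf _ = 0) ?raddf0 //.
  exact: val_inj.
by split=> [/sqcls_eqP|Ix]; [|apply/sqcls_eqP]; rewrite subr0.
Qed.

End SubquotientClasses.

Lemma descent_sqcls_lin (A : comPzRingType) (J I K : ideal A)
    (IV0 : forall a (v : subquo J I), a \in K -> a *: v = 0) t (x y : A)
    (Jx : x \in J) (Jy : y \in J) (Jtxy : t * x + y \in J) :
  rproj K t *: (sqcls I Jx : descent IV0) + (sqcls I Jy : descent IV0) =
  sqcls I Jtxy.
Proof.
by rewrite [_ *: _](descent_scale_proj (IV0 := IV0) t (sqcls I Jx));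
  apply: sqcls_lin.
Qed.

(** * The conormal module, its torsion and the symbolic square through representatives in A *)

Section Conormal.
Variables (A : comPzRingType) (h g : ideal A).
Hypothesis hg : {subset h <= g}.
Implicit Types (x y t : A).
Local Notation gb := (gbar h g).
Local Notation G := (sq_add h g).

Lemma sq_add_sub : {subset G <= g}.
Proof.
apply: ideal_add_sub => //; apply: ideal_mul_sub => x y _; exact: ideal_mulr.
Qed.

Lemma mem_gbar x : rproj h x \in gb <-> x \in g.
Proof.
split=> [/asboolW[y [gy /rproj_eqP/hg xy]]|]; last exact: mem_image_ideal.
by rewrite -[x](subrK y) (idealD xy).
Qed.

(** The square of [gb] is the image of g^2, and taking the preimage adds the kernel h. *)
Lemma mem_gbar_sq x : rproj h x \in ideal_mul gb gb <-> x \in G.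
Proof.
split=> [|]; last first.
  have lh := preim_ideal_like (rproj h) (ideal_mul gb gb).
  apply: (ideal_gen_ind lh) => y [|hy].
  - apply: (ideal_gen_ind lh) => _ [u [v [gu gv ->]]]; rewrite rmorphM.
    by apply: mem_ideal_mul; apply: mem_image_ideal.
  - suff Ey : rproj h y = 0 by have := ideal0 (ideal_mul gb gb); rewrite -Ey.
    by rewrite -(rmorph0 (rproj h)); apply/rproj_eqP; rewrite subr0.
move=> gx; suff [y Gy /rproj_eqP xy] : exists2 y,
  y \in G & rproj h x = rproj h y.
  by rewrite -[x](subrK y) idealD // mem_ideal_addr.
apply: (ideal_gen_ind (S' := fun z => exists2 y, y \in G & z = rproj h y)) gx.
  split=> [|_ _ [y Gy ->] [z Gz ->]|a _ [y Gy ->]].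
  - by exists 0; rewrite ?ideal0 ?rmorph0.
  - by exists (y + z); rewrite ?idealD ?rmorphD.
  - by exists (rrepr a * y); [apply: ideal_mulr|rewrite rmorphM /= rreprK].
move=> _ [_ [_ [/asboolW[y [gy ->]] /asboolW[z [gz ->]] ->]]].
exists (y * z); last by rewrite rmorphM.
by apply/mem_ideal_addl/mem_ideal_mul.
Qed.

(* x represents an element of g that is torsion in g / (g^2 + h). *)
Definition is_torsion x := exists2 t, nzd_mod g t & t * x \in G.

Lemma is_torsion_mem x : is_torsion x -> x \in g.
Proof. by move=> [t tnzd /sq_add_sub/tnzd]. Qed.

Lemma nonzerodiv_proj t : nonzerodiv (rproj g t) <-> nzd_mod g t.
Proof.
have proj0 x : rproj g x = 0 <-> x \in g.
  by rewrite -(rmorph0 (rproj g)); split=> [/rproj_eqP|gx]; [|apply/rproj_eqP];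
    rewrite subr0.
split=> [tnzd x tx|tnzd x]; first by apply/proj0/tnzd; rewrite -rmorphM;
  apply/proj0.
by rewrite -[x]rreprK -rmorphM => /proj0/tnzd/proj0.
Qed.

Lemma conormal_cls_eqP x y (gx : x \in g) (gy : y \in g) :
  conormal_cls h gx = conormal_cls h gy <-> x - y \in G.
Proof.
by rewrite -mem_gbar_sq rmorphB; apply: sqcls_eqP.
Qed.

Lemma conormal_cls_eq0 x (gx : x \in g) : conormal_cls h gx = 0 <-> x \in G.
Proof. by rewrite -mem_gbar_sq; apply: sqcls_eq0. Qed.

Lemma conormal_cls_surj (u : conormal h g) :
  exists x (gx : x \in g), u = conormal_cls h gx.
Proof.
have [y [gy ->]] := sqcls_surj u; have /asboolW[x [gx yx]] := gy.
exists x, gx; apply/sqcls_eqP; rewrite yx subrr; exact: ideal0.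
Qed.

Lemma conormal_cls_scale t x (gx : x \in g) (gtx : t * x \in g) :
  rproj g t *: conormal_cls h gx = conormal_cls h gtx.
Proof.
apply: (etrans (descent_scale_proj (IV0 := @conormal_annihilated A h g) t _)).
apply: (etrans (sqcls_scale _ _ (J :=
  gb) (ideal_mulr (rproj h t) (mem_image_ideal h gx)))).
by apply/sqcls_eqP; rewrite rmorphM subrr; apply: ideal0.
Qed.

Lemma conormal_cls_lin t x y (gx : x \in g) (gy : y \in g) (gtxy : t * x + y
  \in g) :
  rproj g t *: conormal_cls h gx + conormal_cls h gy = conormal_cls h gtxy.
Proof.
rewrite [_ *: _](descent_scale_proj (IV0 := @conormal_annihilated A h g) t _).
have gbtxy : rproj h t *: (rproj h x : (rquot h)^o) + rproj h y \in gb.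
  by apply: idealD; [apply: ideal_mulr|]; apply: mem_image_ideal.
apply: (etrans (sqcls_lin _ (mem_image_ideal h gx) (mem_image_ideal h gy)
  gbtxy)).
by apply/sqcls_eqP; rewrite rmorphD rmorphM subrr; apply: ideal0.
Qed.

Lemma torsion_conormalP x (gx : x \in g) :
  conormal_cls h gx \in torsion (conormal h g) <-> is_torsion x.
Proof.
have gtx t : t * x \in g by apply: ideal_mulr.
split=> [/asboolW[s []]|[t tnzd tx]].
  rewrite -[s]rreprK (conormal_cls_scale _ (gtx _)) => /nonzerodiv_proj tnzd.
  by move/conormal_cls_eq0 => tx; exists (rrepr s).
apply: asboolT; exists (rproj g t); split; first exact/nonzerodiv_proj.
by rewrite (conormal_cls_scale _ (gtx _)); apply/conormal_cls_eq0.
Qed.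

Hypothesis noethA : noetherian A.
Hypothesis g_radical : radical_ideal g.

(** In the Noetherian ring A/h the ideal [gb] is radical, so lying in no minimal prime of [gb] means
    being a non-zero-divisor modulo [gb], that is, modulo g after lifting. *)
Lemma symbolic_squareP x :
  rproj h x \in symbolic_square gb <-> is_torsion x.
Proof.
have noethq : noetherian (rquot h).
  by apply: (noetherian_surj (phi := rproj h)) noethA => b; exists (rrepr b);
    apply: rreprK.
have gb_radical : radical_ideal gb.
  move=> b m; rewrite -[b]rreprK -rmorphXn => /mem_gbar gm.
  exact/mem_gbar/g_radical/gm.
have nzdP t : nzd_mod gb (rproj h t) <-> nzd_mod g t.
  split=> tnzd; first by move=> y /mem_gbar; rewrite rmorphM => /tnzd/mem_gbar.
  by move=> b; rewrite -[b]rreprK -rmorphM => /mem_gbar/tnzd/mem_gbar.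
split=> [/asboolW[s [smin]]|[t tnzd tx]].
  rewrite -[s]rreprK -rmorphM => /mem_gbar_sq sx; exists (rrepr s) => //.
  by apply/nzdP/(nzd_modP noethq _ gb_radical); rewrite rreprK.
apply: asboolT; exists (rproj h t); split.
  exact/(nzd_modP noethq _ gb_radical)/nzdP.
by rewrite -rmorphM; apply/mem_gbar_sq.
Qed.

End Conormal.

(** * The primitive ideal *)

(** A prime P of height p over h contains an associated prime of h, which then has height exactly p;
    unmixedness transfers this to Q. *)
Lemma associated_prime_height (A : comPzRingType) (h Q : ideal A) p :
  noetherian A -> unmixed h -> ideal_height h p -> associated_prime h Q ->
  ~ prime_height_ge Q p.+1.
Proof.
move=> noethA h_unmixed [[P [Pp hP [_ Pp1]]] h_ge] hQ.
have [[s sP]|Q' [hQ' Q'P hQ'1]] := exists_associated_prime noethA (I :=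
  h) (y := 1) Pp.
  by rewrite mulr1 => /hP; rewrite (negPf sP).
have Q'p := hQ'.1; suff /(h_unmixed _ _ hQ' hQ p) [] : prime_height Q' p by [].
split; first by apply: h_ge => // a ha; apply: hQ'1; rewrite mulr1.
by move/(prime_height_ge_sub Pp Q'P).
Qed.

(** If t x is in g^2 + h, then t xi(x) = xi(t x) - xi(t) x lies in g, and t cancels modulo g. *)
Lemma primitive_of_torsion (k : fieldType) (A : comAlgType k) (h g : ideal A) x
  :
  {subset h <= g} -> is_torsion h g x -> x \in primitive_ideal h g.
Proof.
move=> hg xtors; have gx := is_torsion_mem hg xtors.
have [t tnzd tx] := xtors; apply: asboolT; split=> // xi [xiM xih].
have Gg y : y \in sq_add h g -> xi y \in g.
  pose S' (z : A) := z \in g /\ xi z \in g.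
  have S'like : ideal_like S'.
    split=> [|z w [gz xz] [gw xw]|a z [gz xz]].
    - by split; rewrite ?raddf0 ideal0.
    - by split; rewrite ?raddfD idealD.
    - split; first exact: ideal_mulr.
      by rewrite xiM; apply: idealD; apply: ideal_mulr.
  suff SG z : z \in sq_add h g -> S' z by case/SG.
  apply: (ideal_gen_ind S'like) => w [|hw]; last by split;
    [apply: hg|apply/hg/xih].
  apply: (ideal_gen_ind S'like) => _ [u [v [gu gv ->]]].
  split; first exact: ideal_mulr.
  by rewrite xiM; apply: idealD; [apply: ideal_mull|apply: ideal_mulr].
apply: tnzd; rewrite -[t * xi x](addrK (xi t * x)) -xiM.
by apply: idealB; [apply: Gg|apply: ideal_mulr].
Qed.

(** * The primitive ideal at the minimal primes of g *)

Section PrimitiveLoc.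
Variables (k : fieldType) (n : nat).
Hypothesis char_k : [pchar k] =i pred0.
Variables (h g : ideal {mpoly k[n]}).
Hypotheses (hg : {subset h <= g}) (h_unmixed : unmixed h)
  (g_radical : radical_ideal g).
Variables (r : nat) (f : 'I_r -> {mpoly k[n]}).
Hypothesis f_gen : ideal_gen (fun x => exists i, x = f i) =i h.

Lemma loc_uniform (P I : ideal {mpoly k[n]}) (y : 'I_r -> {mpoly k[n]}) :
  prime_ideal P -> (forall i, loc P I (y i)) ->
  exists2 s, s \notin P & forall i, s * y i \in I.
Proof.
move=> Pp ly.
have /choice[s sP] i : exists s, s \notin P /\ s * y i \in I.
  by have [s sP sy] := ly i; exists s.
exists (\prod_i s i) => [|i].
  apply: (big_ind (fun z => z \notin P)) => [|a b|i _]; last exact: (sP i).1.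
    exact: Pp.1.
  exact: prime_mulN.
rewrite (bigD1 i) //= mulrC mulrA [y i * _]mulrC; apply: ideal_mull.
exact: (sP i).2.
Qed.

Lemma primitive_loc (P : ideal {mpoly k[n]}) (x : {mpoly k[n]}) :
  minimal_prime g P -> ~ {subset jacobian_ideal h f <= P} ->
  x \in primitive_ideal (A := {mpoly k[n]}) h g -> loc P (sq_add h g) x.
Proof.
move=> Pmin jacP /asboolW[gx xprim]; have [Pp gP _] := Pmin.
have hP : {subset h <= P} by move=> y /hg/gP.
(* As h is contained in P, it is one of the minors that escapes P. *)
have [p [s [t [h_ht detP]]]] : exists p (s : 'I_p -> 'I_r) (t : 'I_p -> 'I_n),
    ideal_height h p /\ jac_det (f \o s) t \notin P.
  apply: contrapT => none; apply: jacP; apply: ideal_gen_sub => y.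
  case=> [/hP//|[p [s [t [h_ht ->]]]]]; apply: contrapT => /negP detP.
  apply: none; exists p, s, t; split; first exact: h_ht.
  rewrite /jac_det.
  suff <- : mxsub s t (\matrix_(i < r,
    j < n) mderiv j (f i)) = jac_mx (f \o s) t by [].
  by apply/matrixP => i j; rewrite !mxE.
pose F := f \o s.
have Fh i : F i \in h by rewrite -f_gen; apply: mem_ideal_gen; exists (s i).
(* Otherwise an associated prime Q of h inside P contains every a with a [ker_der l y] in h, while
   [ker_der_loc] supplies such an a outside Q. *)
have ker_loc l y : y \in h -> loc P h (ker_der F t l y).
  move=> hy; apply: contrapT =>
    /(exists_associated_prime (@noetherian_mpoly k n) Pp).
  move=> [Q [hQ QP Qy]]; have Qp := hQ.1.
  have hsubQ : {subset h <= Q} by move=> a ha; apply: Qy; apply: ideal_mull.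
  have detQ : jac_det F t \notin Q by apply: contra detP; apply: QP.
  have Qht := associated_prime_height (@noetherian_mpoly k n) h_unmixed h_ht hQ.
  have [u uQ /Qy] := ker_der_loc char_k l Qp detQ hsubQ Fh Qht hy.
  by rewrite (negPf uQ).
have kerP l : ker_der F t l x \in P.
  (* A common denominator u over the finitely many generators of h makes u [ker_der l] a derivation
     preserving h. *)
  have [||u uP uf] := @loc_uniform P h (fun i => ker_der F t l (f i)) => //.
    by move=> i; apply: ker_loc; rewrite -f_gen; apply: mem_ideal_gen; exists i.
  have uder := scale_der u (ker_der_der F t l).
  have ulin : linear (fun y => u * ker_der F t l y).
    by apply: der_linear => // c; rewrite ker_derC mulr0.
  pose xi : {linear {mpoly k[n]} -> {mpoly k[n]}} :=
    HB.pack (fun y =>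
      u * ker_der F t l y) (GRing.isLinear.Build k _ _ _ _ ulin).
  have /gP : xi x \in g.
    apply: xprim; split=> [|y]; first exact: uder.2.
    rewrite -f_gen => /(der_ideal_gen uder) /=; rewrite f_gen; apply.
    by move=> _ [i ->]; rewrite f_gen; apply: uf.
  exact: prime_cancel.
have := loc_square_of_ker_der char_k Pp detP hP Fh (gP _ gx) kerP.
have lG := loc_ideal_like (sq_add h g) Pp.
(* It remains to replace P^2 by g^2, using that g and P agree locally at P. *)
apply: (loc_idem Pp) => y; apply: (ideal_gen_ind lG) => z [hz|].
  exact/(mem_loc Pp)/mem_ideal_addr.
apply: (ideal_gen_ind lG) => _ [u [v [Pu Pv ->]]].
have [a aP au] := minimal_prime_loc (@noetherian_mpoly k n) g_radical Pmin Pu.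
have [b bP bv] := minimal_prime_loc (@noetherian_mpoly k n) g_radical Pmin Pv.
exists (a * b); first exact: prime_mulN.
have -> : a * b * (u * v) = (a * u) * (b * v) by ring.
exact/mem_ideal_addl/mem_ideal_mul.
Qed.

(** The local denominators show that (g^2 + h : x) lies in no minimal prime of g, so this ideal
    contains a single non-zero-divisor modulo g. *)
Lemma primitiveP x :
  (forall P : ideal {mpoly k[n]},
     minimal_prime g P -> ~ {subset jacobian_ideal h f <= P}) ->
  x \in primitive_ideal (A := {mpoly k[n]}) h g <-> is_torsion h g x.
Proof.
move=> jac; split; last exact: primitive_of_torsion.
move=> xprim; have [J JP] := ideal_colon (sq_add h g) x.
have [|t /JP tx tnzd] := exists_nzd_mod (@noetherian_mpoly k n) (J :=
  J) g_radical.
  move=> P Pmin JsubP; have [t tP tx] := primitive_loc Pmin (jac P Pmin) xprim.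
  by move/negP: tP; apply; apply/JsubP/JP.
by exists t.
Qed.

End PrimitiveLoc.

(** * The two descriptions of the torsion and the exact sequence *)

Section TorsionSequence.
Variables (k : fieldType) (A : comAlgType k) (h g : ideal A).
Hypotheses (hg : {subset h <= g}) (noethA : noetherian A)
  (g_radical : radical_ideal g).
Local Notation M := (conormal h g).
Local Notation M' := (lift_conormal h g).
Local Notation TM := (submod_of (torsion M)).
Local Notation N := (primitive_quotient h g).
Local Notation gb := (gbar h g).
Local Notation gb_sq := (ideal_mul gb gb).
Local Notation prim := (primitive_ideal h g).
Hypothesis primP : forall x : A, x \in prim <-> is_torsion h g x.

Lemma sq_add_primitive (x : A) : x \in sq_add h g -> x \in prim.
Proof.
by move=> Gx; apply/primP; exists 1; [move=> y; rewrite mul1r|rewrite mul1r].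
Qed.

Lemma torsion_primitive (x : A) (gx : x \in g) :
  conormal_cls h gx \in torsion M <-> x \in prim.
Proof.
by split=> [/torsion_conormalP/primP|/primP/(torsion_conormalP h gx)].
Qed.

Lemma lift_conormal_iso : exists theta : {linear M' -> M},
  [/\ bijective theta,
      forall (x : A) (gx : x \in g),
        theta (sqcls (sq_add h g) gx) = conormal_cls h gx &
      forall m : M, m \in torsion M <->
        exists2 t : M', t \in subquo_sub g (sq_add h g) prim & theta t = m].
Proof.
pose rho (u : M') (v : M) := exists x (gx : x \in g),
  u = sqcls (sq_add h g) gx /\ v = conormal_cls h gx.
have [||| theta thetaP] := linear_of_rel (rho := rho).
+ by move=> u; have [x [gx ->]] := sqcls_surj u;
    exists (conormal_cls h gx), x, gx.
+ move=> u v w [x [gx [-> ->]]] [y [gy [/sqcls_eqP xy ->]]].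
  exact/conormal_cls_eqP.
+ move=> a _ _ _ _ [x [gx [-> ->]]] [y [gy [-> ->]]].
  have gaxy : rrepr a * x + y \in g by apply: idealD => //; apply: ideal_mulr.
  exists (rrepr a * x + y), gaxy; split; rewrite -[a in LHS]rreprK.
    exact: descent_sqcls_lin.
  exact: conormal_cls_lin.
have thetaE (x : A) (gx : x \in g) :
    theta (sqcls (sq_add h g) gx) = conormal_cls h gx.
  have [y [gy [/sqcls_eqP xy ->]]] := thetaP (sqcls (sq_add h g) gx).
  apply/conormal_cls_eqP; rewrite -opprB -mulN1r; exact: ideal_mulr.
exists theta; split=> //.
  apply: inj_surj_bij => [u v|m].
    have [x [gx [-> ->]]] := thetaP u; have [y [gy [-> ->]]] := thetaP v.
    by move/conormal_cls_eqP=> ?; apply/sqcls_eqP.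
  have [x [gx ->]] := conormal_cls_surj m.
  by exists (sqcls (sq_add h g) gx).
move=> m; have [x [gx ->]] := conormal_cls_surj m; split.
  move/torsion_primitive => px; exists (sqcls (sq_add h g) gx) => //.
  by apply: asboolT; exists x, gx.
case=> _ /asboolW[y [gy [py ->]]]; rewrite thetaE => /conormal_cls_eqP yx.
apply/torsion_primitive; rewrite -[x](subKr y); apply: idealB => //.
exact: sq_add_primitive.
Qed.

(** Both sides consist of classes modulo g^2 + h of the x satisfying [is_torsion]. One is a module
    over A/h and the other over A/g, hence the restriction of scalars to A. *)
Lemma torsion_symbolic_iso : exists psi : {linear
    restr (rproj h) (subquo (symbolic_square gb) gb_sq) ->
    restr (rproj g) TM},
  bijective psi /\
  forall (y : rquot h) (y2 : y \in symbolic_square gb),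
    exists gy : y \in gb,
      val (psi (sqcls gb_sq y2) : submod_of (torsion M)) = sqcls gb_sq gy.
Proof.
have symP (x : A) : rproj h x \in symbolic_square gb <-> is_torsion h g x.
  exact: symbolic_squareP.
have sym_g (x : A) : rproj h x \in symbolic_square gb -> x \in g.
  by move/symP/(is_torsion_mem hg).
pose U := restr (rproj h) (subquo (symbolic_square gb) gb_sq).
pose rho (u : U) (v : restr (rproj g) TM) :=
  exists x (gx : x \in g) (x2 : rproj h x \in symbolic_square gb),
    u = sqcls gb_sq x2 /\ val (v : submod_of (torsion M)) = conormal_cls h gx.
have [||| psi psiP] := linear_of_rel (rho := rho).
+ move=> u; have [y [y2 ->]] := sqcls_surj u.
  move: y2; rewrite -[y]rreprK => y2; have gx := sym_g _ y2.
  have tx : conormal_cls h gx \in torsion M.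
    by apply/torsion_conormalP/symP.
  by exists (SubmodOf tx), (rrepr y), gx, y2.
+ move=> u v w [x [gx [x2 [-> Ev]]]] [y [gy [y2 [/sqcls_eqP xy Ew]]]].
  apply: val_inj; rewrite Ev Ew; apply/conormal_cls_eqP.
  by apply/mem_gbar_sq; rewrite // rmorphB.
+ move=> a _ _ v v' [x [gx [x2 [-> Ev]]]] [y [gy [y2 [-> Ev']]]].
  have gaxy : a * x + y \in g by apply: idealD => //; apply: ideal_mulr.
  have a2 : rproj h a *: (rproj h x : (rquot h)^o) + rproj h y
      \in symbolic_square gb := rpredD (rpredZ (rproj h a) x2) y2.
  have projE : rproj h (a * x + y) = rproj h a * rproj h x + rproj h y.
    by rewrite rmorphD rmorphM.
  have axy2 : rproj h (a * x + y) \in symbolic_square gb by rewrite projE.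
  exists (a * x + y), gaxy, axy2; split.
    apply: (etrans (sqcls_lin gb_sq x2 y2 a2)).
    by apply/sqcls_eqP; rewrite projE subrr; apply: ideal0.
  apply: (etrans _ (conormal_cls_lin h gx gy gaxy)); rewrite -Ev -Ev'.
  exact: (linearP (val : {linear TM -> M}) (rproj g a) v v').
exists psi; split.
  apply: inj_surj_bij => [u v|m].
    have [x [gx [x2 [-> Ev]]]] := psiP u; have [y [gy [y2 [-> Ew]]]] := psiP v.
    move=> Evw; apply/sqcls_eqP; rewrite -rmorphB; apply/mem_gbar_sq => //.
    by apply/(conormal_cls_eqP h gx gy); rewrite -Ev -Ew Evw.
  have [x [gx Em]] := conormal_cls_surj (val (m : submod_of (torsion M))).
  have x2 : rproj h x \in symbolic_square gb.
    by apply/symP/(torsion_conormalP h gx); rewrite -Em; apply: valP.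
  exists (sqcls gb_sq x2).
  have [y [gy [y2 [/sqcls_eqP xy Ey]]]] := psiP (sqcls gb_sq x2).
  apply: val_inj; rewrite Em Ey; apply/esym/conormal_cls_eqP/mem_gbar_sq.
  by rewrite rmorphB.
move=> y y2; have [x [gx [x2 [/sqcls_eqP yx Ex]]]] := psiP (sqcls gb_sq y2).
have gy : y \in gb.
  by have := y2; rewrite -[y]rreprK => /sym_g; apply: mem_image_ideal.
by exists gy; rewrite Ex; apply/esym/sqcls_eqP.
Qed.

(** The projection is well defined because g^2 + h lies in the primitive ideal, and its kernel is
    the torsion by [torsion_primitive]. *)
Lemma conormal_exact :
  let M : lmodType (rquot g) := conormal h g in
  let TM : lmodType (rquot g) := submod_of (torsion M) in
  let N : lmodType (rquot g) := primitive_quotient h g in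
  exists p : {linear M -> N},
    (forall (x : A) (gx : x \in g), p (conormal_cls h gx) = sqcls prim gx) /\
    short_exact (val : {linear TM -> M}) p.
Proof.
move=> M TM N.
pose rho (u : M) (v : N) := exists x (gx : x \in g),
  u = conormal_cls h gx /\ v = sqcls prim gx.
have [||| p pP] := linear_of_rel (rho := rho).
+ by move=> u; have [x [gx ->]] := conormal_cls_surj u;
    exists (sqcls prim gx), x, gx.
+ move=> u v w [x [gx [-> ->]]] [y [gy [/conormal_cls_eqP xy ->]]].
  exact/sqcls_eqP/sq_add_primitive.
+ move=> a _ _ _ _ [x [gx [-> ->]]] [y [gy [-> ->]]].
  have gaxy : rrepr a * x + y \in g by apply: idealD => //; apply: ideal_mulr.
  exists (rrepr a * x + y), gaxy; split; rewrite -[a in LHS]rreprK.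
    exact: conormal_cls_lin.
  exact: descent_sqcls_lin.
have pE (x : A) (gx : x \in g) : p (conormal_cls h gx) = sqcls prim gx.
  have [y [gy [/conormal_cls_eqP xy ->]]] := pP (conormal_cls h gx).
  by apply/esym/sqcls_eqP/sq_add_primitive.
exists p; split=> //; split; first exact: val_inj.
  move=> m; have [x [gx ->]] := conormal_cls_surj m; rewrite pE; split.
    by move=> /sqcls_eq0/torsion_primitive-/(_ gx) tx; exists (SubmodOf tx).
  by case=> u Eu; apply/sqcls_eq0/(torsion_primitive gx); rewrite -Eu;
    apply: valP.
move=> v; have [x [gx ->]] := sqcls_surj v.
by exists (conormal_cls h gx).
Qed.

End TorsionSequence.

Theorem proposition4 (k : fieldType) (char_k : [pchar k] =i pred0) (n : nat)
    (h g : ideal {mpoly k[n]}) (h_sub_g : {subset h <= g})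
    (h_unmixed : unmixed h) (g_unmixed : unmixed g) (g_radical : radical_ideal g)
    (r : nat) (f : 'I_r -> {mpoly k[n]})
    (f_gen : ideal_gen (fun x => exists i, x = f i) =i h)
    (jac : forall P : ideal {mpoly k[n]},
        minimal_prime g P -> ~ {subset jacobian_ideal h f <= P}) :
  let O : comAlgType k := {mpoly k[n]} in
  let M : lmodType (rquot g) := conormal h g in
  let M' : lmodType (rquot g) := lift_conormal h g in
  let TM : lmodType (rquot g) := submod_of (torsion M) in
  let N : lmodType (rquot g) := primitive_quotient h g in
  let gb := gbar h g in
  let gb_sq := ideal_mul gb gb in
  let prim : ideal O := primitive_ideal h g in
  (* M is canonically g / (g^2 + h), and T(M) = prim / (g^2 + h) *)
  (exists theta : {linear M' -> M},
     [/\ bijective theta,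
         forall (x : O) (gx : x \in g),
           theta (sqcls (sq_add h g) gx) = conormal_cls h gx &
         forall m : M, m \in torsion M <->
           exists2 t : M', t \in subquo_sub g (sq_add h g) prim & theta t = m])
  /\
  (* T(M) is canonically isomorphic to gb^(2) / gb^2, as an O-module *)
  (exists psi : {linear
       restr (rproj h) (subquo (symbolic_square gb) gb_sq) ->
       restr (rproj g) TM},
     bijective psi /\
     forall (y : rquot h) (y2 : y \in symbolic_square gb),
       exists gy : y \in gb,
         val (psi (sqcls gb_sq y2) : submod_of (torsion M)) = sqcls gb_sq gy)
  /\
  (* 0 -> T(M) -> M -> N -> 0 *)
  (exists p : {linear M -> N},
     (forall (x : O) (gx : x \in g),
        p (conormal_cls h gx) = sqcls prim gx) /\
     short_exact (val : {linear TM -> M}) p).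
Proof.
have noethO := @noetherian_mpoly k n.
have primP x := primitiveP char_k h_sub_g h_unmixed g_radical f_gen x jac.
split; first exact (@lift_conormal_iso k {mpoly k[n]} h g primP).
split; first exact (@torsion_symbolic_iso k {mpoly k[n]} h g h_sub_g noethO
  g_radical).
exact (@conormal_exact k {mpoly k[n]} h g primP).
Qed.
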